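(* Let $\Theta=(\theta_{k,\ell})$ be an ergodic real antisymmetric $d\times d$ matrix. For every $\varepsilon>0$ there exists $\delta>0$ such that for every separable Hilbert space $\mathcal H$ and every $\delta$-almost $\Theta$-commuting unitary $d$-tuple $U=(U_1,\dots,U_d)$ on $\mathcal H$ there exists a $\Theta$-commuting unitary $d$-tuple $V_\Theta$ on $\mathcal H\otimes\ell^2$ such that $$\|U\otimes \mathrm{id}_{\ell^2}-V_\Theta\|<\varepsilon .$$
   Context: Let $\Theta=(\theta_{k,\ell})$ be a real antisymmetric $d\times d$ matrix and $Q=(q_{k,\ell})$ with $q_{k,\ell}=e^{i\theta_{k,\ell}}$. $\Theta$ is called ergodic if the subgroup of $\mathbb T^d$ generated by the columns of $Q$ is dense in $\mathbb T^d$. A unitary tuple $V=(V_1,\dots,V_d)$ is $\Theta$-commuting if $V_\ell V_k=e^{i\theta_{k,\ell}}V_kV_\ell$ for all $k,\ell=1,\dots,d$. For $\delta>0$, a unitary tuple $U$ is $\delta$-almost $\Theta$-commuting if $\|U_\ell U_k-e^{i\theta_{k,\ell}}U_kU_\ell\|\le\delta$ for all $k,\ell=1,\dots,d$. For operator $d$-tuples on the same Hilbert space, $\|A-B\|=\max_{1\le i\le d}\|A_i-B_i\|$. $U\otimes\mathrm{id}_{\ell^2}=(U_1\otimes\mathrm{id}_{\ell^2},\dots,U_d\otimes\mathrm{id}_{\ell^2})$, where $\ell^2$ is the separable infinite-dimensional Hilbert space. *)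

(* Defs.v *)
From HB Require Import structures.
From mathcomp Require Import all_boot all_order all_algebra all_classical all_reals.
From mathcomp Require Import topology ereal normedtype sequences trigo.
From mathcomp Require Import complex ring lra.

Set Implicit Arguments.
Unset Strict Implicit.
Unset Printing Implicit Defensive.

Import Order.TTheory GRing.Theory Num.Theory.
Import numFieldNormedType.Exports.

Local Open Scope classical_set_scope.
Local Open Scope ring_scope.
Local Open Scope complex_scope.

(* The inner product is linear in its first argument.                         *)
HB.mixin Record NormedModule_hasInner (R : realType) H
    & NormedModule R[i] H := {
  inner : H -> H -> R[i] ;
  innerPl : forall (a : R[i]) x y z,
    inner (a *: x + y) z = a * inner x z + inner y z ;
  innerC : forall x y, inner y x = conjc (inner x y) ;
  inner_normE : forall x, inner x x = `|x| ^+ 2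
}.

#[short(type="preHilbertType")]
HB.structure Definition PreHilbert (R : realType) :=
  {H of NormedModule R[i] H & NormedModule_hasInner R H}.

#[short(type="hilbertType")]
HB.structure Definition Hilbert (R : realType) :=
  {H of PreHilbert R H & Complete H}.

Section complex_aux.
Context {R : realType}.
Implicit Types x y : R[i].

Lemma ReD x y : complex.Re (x + y) = complex.Re x + complex.Re y.
Proof. by case: x y => [a b] [c d]. Qed.
Lemma ImD x y : complex.Im (x + y) = complex.Im x + complex.Im y.
Proof. by case: x y => [a b] [c d]. Qed.
Lemma ReN x : complex.Re (- x) = - complex.Re x. Proof. by case: x. Qed.
Lemma ImN x : complex.Im (- x) = - complex.Im x. Proof. by case: x. Qed.
Lemma ReM x y : complex.Re (x * y) =
  complex.Re x * complex.Re y - complex.Im x * complex.Im y.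
Proof. by case: x y => [a b] [c d]. Qed.
Lemma ImM x y : complex.Im (x * y) =
  complex.Re x * complex.Im y + complex.Im x * complex.Re y.
Proof. by case: x y => [a b] [c d]. Qed.
Lemma ReJ x : complex.Re (conjc x) = complex.Re x. Proof. by case: x. Qed.
Lemma ImJ x : complex.Im (conjc x) = - complex.Im x. Proof. by case: x. Qed.
Lemma complex_ext x y :
  complex.Re x = complex.Re y -> complex.Im x = complex.Im y -> x = y.
Proof. by case: x y => [a b] [c d] /= -> ->. Qed.

End complex_aux.

(* In MathComp-Analysis the norm of a normed module over [R[i]] lives in      *)
(* [R[i]]; [rnorm] is the same norm as an element of [R].                     *)
Definition rnorm (R : realType) (V : normedModType R[i]) (x : V) : R :=
  complex.Re `|x|.

Section rnorm.
Context {R : realType} {V : normedModType R[i]}.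
Implicit Types x y : V.

Lemma rnormE x : `|x| = (rnorm x)%:C.
Proof. by rewrite /rnorm RRe_real// ger0_real. Qed.

Lemma rnorm_ge0 x : 0 <= rnorm x.
Proof. by rewrite -ler0c -rnormE. Qed.

Lemma rnorm0 : rnorm (0 : V) = 0.
Proof. by rewrite /rnorm normr0. Qed.

Lemma rnorm_eq0 x : rnorm x = 0 -> x = 0.
Proof. by move=> h; apply/eqP; rewrite -normr_eq0 rnormE h. Qed.

Lemma rnormN x : rnorm (- x) = rnorm x.
Proof. by rewrite /rnorm normrN. Qed.

Lemma rnormD x y : rnorm (x + y) <= rnorm x + rnorm y.
Proof. by rewrite -lecR rmorphD/= -!rnormE ler_normD. Qed.

Lemma rnormZ (a : R[i]) x : rnorm (a *: x) = complex.Re `|a| * rnorm x.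
Proof.
rewrite {1}/rnorm normrZ ReM [X in _ - _ * X](_ : _ = 0) ?mulr0 ?subr0//.
by rewrite ger0_Im.
Qed.

End rnorm.

Section inner_space.
Context {R : realType} {H : preHilbertType R}.
Implicit Types (x y z : H) (a : R[i]).

Lemma innerDl x y z : inner (x + y) z = inner x z + inner y z.
Proof. by rewrite -[x]scale1r innerPl mul1r scale1r. Qed.
Lemma inner0l z : inner (0 : H) z = 0.
Proof. by apply: (addrI (inner (0 : H) z)); rewrite -innerDl !addr0. Qed.
Lemma innerZl a x z : inner (a *: x) z = a * inner x z.
Proof. by rewrite -[_ *: x]addr0 innerPl inner0l addr0. Qed.
Lemma innerNl x z : inner (- x) z = - inner x z.
Proof. by rewrite -scaleN1r innerZl mulN1r. Qed.
Lemma innerDr x y z : inner z (x + y) = inner z x + inner z y.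
Proof. by rewrite innerC innerDl rmorphD/= -!innerC. Qed.
Lemma innerZr a x z : inner z (a *: x) = conjc a * inner z x.
Proof. by rewrite innerC innerZl rmorphM/= -!innerC. Qed.
Lemma inner0r z : inner z (0 : H) = 0.
Proof. by rewrite innerC inner0l conjc0. Qed.
Lemma innerNr x z : inner z (- x) = - inner z x.
Proof. by rewrite innerC innerNl rmorphN/= -!innerC. Qed.

Lemma inner_rnormE x : inner x x = (rnorm x ^+ 2)%:C.
Proof. by rewrite inner_normE rnormE -rmorphXn. Qed.

Lemma rnorm_sqrD x y :
  rnorm (x + y) ^+ 2 = rnorm x ^+ 2 + rnorm y ^+ 2 + 2 * complex.Re (inner x y).
Proof.
apply: complexI; rewrite -inner_rnormE innerDl !innerDr (innerC x y).
rewrite !inner_rnormE; apply: complex_ext.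
  rewrite !ReD ReJ/=; ring.
rewrite !ImD ImJ/=; ring.
Qed.

Lemma Re_inner_le x y :
  `|complex.Re (inner x y)| <= rnorm x ^+ 2 + rnorm y ^+ 2.
Proof.
have := sqr_ge0 (rnorm (x + y)); have := sqr_ge0 (rnorm (x - y)).
rewrite !rnorm_sqrD rnormN innerNr ReN ler_norml.
have := sqr_ge0 (rnorm x); have := sqr_ge0 (rnorm y).
move=> *; lra.
Qed.

Lemma Im_inner_le x y :
  `|complex.Im (inner x y)| <= rnorm x ^+ 2 + rnorm y ^+ 2.
Proof.
have := Re_inner_le (- 'i%C *: x) y.
rewrite innerZl rnormZ normrN (_ : complex.Re `|'i%C| = 1) ?mul1r; last first.
  by rewrite normc_def/= expr0n/= expr1n add0r sqrtr1.
by rewrite ReM ReN ImN /= oppr0 mul0r sub0r mulN1r opprK.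
Qed.

End inner_space.

HB.factory Record Lmodule_hasInner (R : realType) H & GRing.Lmodule R[i] H := {
  inner : H -> H -> R[i] ;
  innerPl : forall (a : R[i]) x y z,
    inner (a *: x + y) z = a * inner x z + inner y z ;
  innerC : forall x y, inner y x = conjc (inner x y) ;
  inner_ge0 : forall x, 0 <= inner x x ;
  inner_eq0 : forall x, inner x x = 0 -> x = 0
}.

HB.builders Context R H & Lmodule_hasInner R H.

Let sq x : R := complex.Re (inner x x).

Let inner_sq x : inner x x = (sq x)%:C.
Proof. by rewrite /sq RRe_real// ger0_real// inner_ge0. Qed.

Let sq_ge0 x : 0 <= sq x.
Proof. by rewrite -ler0c -inner_sq inner_ge0. Qed.

Let innerDl x y z : inner (x + y) z = inner x z + inner y z.
Proof. by rewrite -[x]scale1r innerPl mul1r scale1r. Qed.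
Let inner0l z : inner 0 z = 0.
Proof. by apply: (addrI (inner 0 z)); rewrite -innerDl !addr0. Qed.
Let innerZl a x z : inner (a *: x) z = a * inner x z.
Proof. by rewrite -[_ *: x]addr0 innerPl inner0l addr0. Qed.
Let innerDr x y z : inner z (x + y) = inner z x + inner z y.
Proof. by rewrite innerC innerDl rmorphD/= -!innerC. Qed.
Let innerZr a x z : inner z (a *: x) = conjc a * inner z x.
Proof. by rewrite innerC innerZl rmorphM/= -!innerC. Qed.

Let sqD x y : sq (x + y) = sq x + sq y + 2 * complex.Re (inner x y).
Proof.
rewrite /sq innerDl !innerDr (innerC x y) !ReD ReJ; ring.
Qed.

Let sqZ a x : sq (a *: x) = complex.Re `|a| ^+ 2 * sq x.
Proof.
have /RRe_real <- : `|a| \is Num.real by rewrite ger0_real.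
rewrite {1}/sq innerZl innerZr mulrA -sqr_normc inner_sq.
have /RRe_real <- : `|a| \is Num.real by rewrite ger0_real.
by rewrite -rmorphXn -rmorphM.
Qed.

Let norm x : R[i] := (Num.sqrt (sq x))%:C.

Let normD x y : norm (x + y) <= norm x + norm y.
Proof.
rewrite -rmorphD lecR -[leRHS]ger0_norm ?addr_ge0 ?sqrtr_ge0//.
rewrite -sqrtr_sqr ler_wsqrtr// sqD sqrrD !sqr_sqrtr//.
rewrite [leRHS]addrAC lerD2l -[leRHS]mulr_natl ler_wpM2l//.
set p := Num.sqrt (sq x); set q := Num.sqrt (sq y).
have pE : p ^+ 2 = sq x by rewrite sqr_sqrtr.
have qE : q ^+ 2 = sq y by rewrite sqr_sqrtr.
have p0 : 0 <= p by exact: sqrtr_ge0.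
have q0 : 0 <= q by exact: sqrtr_ge0.
have [xE|x0] := eqVneq x 0.
  by rewrite xE inner0l/= mulr_ge0.
have [yE|y0] := eqVneq y 0.
  by rewrite yE innerC inner0l/= mulr_ge0.
have lt0 z : z != 0 -> 0 < sq z.
  move=> z0; rewrite lt_neqAle sq_ge0 andbT eq_sym.
  by apply: contra z0 => /eqP sz; apply/eqP/inner_eq0; rewrite inner_sq sz.
have pq : 0 < p * q by rewrite mulr_gt0// sqrtr_gt0 lt0.
have nE (t : R) : complex.Re `|t%:C| ^+ 2 = t ^+ 2.
  by rewrite normc_def/= expr0n/= addr0 sqrtr_sqr real_normK ?num_real.
have := sq_ge0 (q%:C *: x + (- p)%:C *: y).
rewrite sqD !sqZ innerZl innerZr !nE -pE -qE !ReM.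
rewrite [X in 0 <= X](_ : _ = 2 * (p * q) * (p * q - complex.Re (inner x y))).
  by rewrite pmulr_rge0 ?subr_ge0// mulr_gt0.
by case: (inner x y) => r s; rewrite /=; ring.
Qed.

Let normZ (a : R[i]) x : norm (a *: x) = `|a| * norm x.
Proof.
have aE : (complex.Re `|a|)%:C = `|a| by rewrite RRe_real ?ger0_real.
have a0 : 0 <= complex.Re `|a| by rewrite -ler0c aE.
by rewrite /norm sqZ sqrtrM ?sqr_ge0// sqrtr_sqr ger0_norm// rmorphM/= aE.
Qed.

Let norm_eq0 x : norm x = 0 -> x = 0.
Proof.
move=> /(congr1 (@complex.Re R))/= /eqP; rewrite sqrtr_eq0 => sx.
apply: inner_eq0; rewrite inner_sq; congr (_ %:C).
by apply/eqP; rewrite eq_le sx sq_ge0.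
Qed.

Let inner_normE x : inner x x = norm x ^+ 2.
Proof. by rewrite inner_sq -rmorphXn/= sqr_sqrtr. Qed.

HB.instance Definition _ :=
  @Lmodule_isNormed.Build R[i] H norm normD normZ norm_eq0.

HB.instance Definition _ :=
  @NormedModule_hasInner.Build R H inner innerPl innerC inner_normE.

HB.end.

Section rnorm_cvg.
Context {R : realType} {V : normedModType R[i]}.

Lemma rnorm_dist (x y : V) : `|rnorm x - rnorm y| <= rnorm (x - y).
Proof.
have h (u v : V) : rnorm u - rnorm v <= rnorm (u - v).
  by rewrite lerBlDr -{1}(subrK v u) rnormD.
by rewrite ler_norml h andbT lerNl opprB -[X in _ <= X]rnormN opprB h.
Qed.

Lemma rnorm_cvg T (F : set_system T) (FF : Filter F) (f : T -> V) y :
  f x @[x --> F] --> y -> rnorm (f x) @[x --> F] --> rnorm y.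
Proof.
move=> /cvgrPdist_lt fy; apply/cvgrPdist_lt => e e0.
have /fy : (0 : R[i]) < e%:C by rewrite ltcR.
apply: filterS => t; rewrite rnormE ltcR.
exact: le_lt_trans (rnorm_dist _ _).
Qed.

End rnorm_cvg.

(* [ell2 H] is the Hilbert space of square-summable sequences in [H]; it is   *)
(* the model used for the Hilbert space tensor product of [H] with            *)
(* [ell2 R[i]] (see [ell2_tensorP]).                                          *)
Section ell2_def.
Context {R : realType} (H : hilbertType R).

Definition square_summable : {pred nat -> H} :=
  [pred x : nat -> H | `[< cvgn (series (fun k => rnorm (x k) ^+ 2)) >]].

Record ell2 := Ell2 {
  ell2_fun :> nat -> H ;
  ell2_summable : ell2_fun \in square_summable
}.

HB.instance Definition _ := [isSub for ell2_fun].
HB.instance Definition _ := [Choice of ell2 by <:].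

Lemma square_summableP (x : nat -> H) :
  (x \in square_summable) <-> cvgn (series (fun k => rnorm (x k) ^+ 2)).
Proof. by split => [/asboolP//|h]; exact/asboolP. Qed.

Lemma square_summable_submod : submod_closed square_summable.
Proof.
split.
  apply/square_summableP; rewrite (_ : series _ = cst 0); first exact: is_cvg_cst.
  apply/funext => n; rewrite /series/= big1// => k _.
  by rewrite rnorm0 expr0n.
move=> a x y /square_summableP xs /square_summableP ys; apply/square_summableP.
pose c : R := complex.Re `|a| ^+ 2.
apply: (@series_le_cvg _ _
  ((2 * c) *: (fun k => rnorm (x k) ^+ 2) + 2 *: (fun k => rnorm (y k) ^+ 2))).
- by move=> n; exact: sqr_ge0.
- by move=> n; rewrite addr_ge0// mulr_ge0 ?sqr_ge0// mulr_ge0 ?sqr_ge0.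
- move=> n; rewrite /= -[X in _ <= X]/(2 * c * _ + 2 * _).
  rewrite -mulrA /c -exprMn -rnormZ.
  have := rnormD (a *: x n) (y n).
  have := rnorm_ge0 (a *: x n + y n).
  move: (rnorm (a *: x n + y n)) (rnorm (a *: x n)) (rnorm (y n)) => s u v *.
  have := sqr_ge0 (u - v).
  have : s ^+ 2 <= (u + v) ^+ 2 by rewrite ler_sqr// nnegrE; lra.
  by rewrite !expr2; lra.
- by apply: is_cvg_seriesD; exact: is_cvg_seriesZ.
Qed.

HB.instance Definition _ :=
  GRing.isSubmodClosed.Build _ _ square_summable square_summable_submod.
HB.instance Definition _ := [SubChoice_isSubLmodule of ell2 by <:].

Implicit Types x y z : ell2.

Lemma ell2D x y k : (x + y) k = x k + y k. Proof. by []. Qed.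
Lemma ell2Z (a : R[i]) x k : (a *: x) k = a *: x k. Proof. by []. Qed.
Lemma ell2N x k : (- x) k = - x k. Proof. by []. Qed.

Lemma ell2_cvg x : cvgn (series (fun k => rnorm (x k) ^+ 2)).
Proof. exact/square_summableP/ell2_summable. Qed.

Lemma ell2_dom_cvg (u : nat -> R) x y :
  (forall k, `|u k| <= rnorm (x k) ^+ 2 + rnorm (y k) ^+ 2) -> cvgn (series u).
Proof.
move=> uxy; apply: normed_cvg; apply: (@series_le_cvg _ _
  ((fun k => rnorm (x k) ^+ 2) + (fun k => rnorm (y k) ^+ 2))) => //.
- by move=> n; exact: normr_ge0.
- by move=> n; exact: (addr_ge0 (sqr_ge0 _) (sqr_ge0 _)).
- by apply: is_cvg_seriesD; exact: ell2_cvg.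
Qed.

Lemma ell2_Re_cvg x y : cvgn (series (fun k => complex.Re (inner (x k) (y k)))).
Proof. by apply: (@ell2_dom_cvg _ x y) => k; exact: Re_inner_le. Qed.

Lemma ell2_Im_cvg x y : cvgn (series (fun k => complex.Im (inner (x k) (y k)))).
Proof. by apply: (@ell2_dom_cvg _ x y) => k; exact: Im_inner_le. Qed.

(* The sum of the series [inner (x k) (y k)], computed componentwise. *)
Definition ell2_inner x y : R[i] :=
  limn (series (fun k => complex.Re (inner (x k) (y k)))) +i*
  limn (series (fun k => complex.Im (inner (x k) (y k)))).

Lemma ell2_innerPl (a : R[i]) x y z :
  ell2_inner (a *: x + y) z = a * ell2_inner x z + ell2_inner y z.
Proof.
pose re x y : R^nat := fun k => complex.Re (inner (x k) (y k)).
pose im x y : R^nat := fun k => complex.Im (inner (x k) (y k)).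
have cre u v : cvgn (series (re u v)) by exact: ell2_Re_cvg.
have cim u v : cvgn (series (im u v)) by exact: ell2_Im_cvg.
have cZ (u : R^nat) (c : R) : cvgn (series u) -> cvgn (series (c *: u)).
  exact: is_cvg_seriesZ.
apply: complex_ext; rewrite ?(ReD, ReM, ImD, ImM)/=.
  rewrite -/(re _ _) -/(re _ _) -/(im _ _).
  rewrite [X in series X](_ : _ = (complex.Re a *: re x z
     - complex.Im a *: im x z) + re y z); last first.
    apply/funext => k.
    rewrite -[LHS]/(complex.Re (inner (a *: x k + y k) (z k))).
    by rewrite innerPl ReD ReM.
  by rewrite (lim_seriesD (is_cvg_seriesB (cZ _ _ (cre _ _)) (cZ _ _ (cim _ _)))
    (cre _ _)) (lim_seriesB (cZ _ _ (cre _ _)) (cZ _ _ (cim _ _)))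
    (lim_seriesZ _ (cre _ _)) (lim_seriesZ _ (cim _ _)).
rewrite -/(re _ _) -/(im _ _) -/(im _ _).
rewrite [X in series X](_ : _ = (complex.Re a *: im x z
     + complex.Im a *: re x z) + im y z); last first.
  apply/funext => k.
  rewrite -[LHS]/(complex.Im (inner (a *: x k + y k) (z k))).
  by rewrite innerPl ImD ImM.
by rewrite (lim_seriesD (is_cvg_seriesD (cZ _ _ (cim _ _)) (cZ _ _ (cre _ _)))
  (cim _ _)) (lim_seriesD (cZ _ _ (cim _ _)) (cZ _ _ (cre _ _)))
  (lim_seriesZ _ (cre _ _)) (lim_seriesZ _ (cim _ _)).
Qed.

Lemma ell2_innerC x y : ell2_inner y x = conjc (ell2_inner x y).
Proof.
apply: complex_ext => /=.
  congr (limn (series _)); apply/funext => k.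
  by rewrite innerC ReJ.
rewrite -lim_seriesN; last exact: ell2_Im_cvg.
congr (limn (series _)); apply/funext => k.
by rewrite innerC ImJ.
Qed.

Lemma ell2_inner_sq x :
  ell2_inner x x = (limn (series (fun k => rnorm (x k) ^+ 2)))%:C.
Proof.
apply: complex_ext => /=.
  by congr (limn (series _)); apply/funext => k; rewrite inner_rnormE.
rewrite [X in series X](_ : _ = cst 0).
  rewrite [X in limn X](_ : _ = cst 0) ?lim_cst//.
  by apply/funext => n; rewrite /series/= big1.
by apply/funext => k; rewrite inner_rnormE.
Qed.

Lemma ell2_partial_le x n :
  \sum_(0 <= k < n) rnorm (x k) ^+ 2 <=
  limn (series (fun k => rnorm (x k) ^+ 2)).
Proof.
have nd : nondecreasing_seq (series (fun k => rnorm (x k) ^+ 2)).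
  by apply: nondecreasing_series => k _ _; exact: sqr_ge0.
exact: (nondecreasing_cvgn_le nd (@ell2_cvg x) n).
Qed.

Lemma ell2_inner_ge0 x : 0 <= ell2_inner x x.
Proof.
rewrite ell2_inner_sq ler0c; apply: le_trans (ell2_partial_le x 0).
by rewrite big_geq.
Qed.

Lemma ell2_inner_eq0 x : ell2_inner x x = 0 -> x = 0.
Proof.
rewrite ell2_inner_sq => /(congr1 (@complex.Re R))/= x0.
apply/val_inj/funext => n /=; apply: rnorm_eq0; apply/eqP.
have := ell2_partial_le x n.+1; rewrite x0 big_nat_recr//= => h.
rewrite -sqrf_eq0 eq_le sqr_ge0 andbT; apply: le_trans h.
by rewrite lerDr sumr_ge0// => k _; exact: sqr_ge0.
Qed.

HB.instance Definition _ := @Lmodule_hasInner.Build R ell2 ell2_inner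
  ell2_innerPl ell2_innerC ell2_inner_ge0 ell2_inner_eq0.

Lemma ell2_rnorm_sq x :
  rnorm x ^+ 2 = limn (series (fun k => rnorm (x k) ^+ 2)).
Proof.
apply: complexI; rewrite -ell2_inner_sq.
by rewrite -[ell2_inner x x]/(inner x x) inner_normE rnormE rmorphXn.
Qed.

Lemma rnorm_ell2_le (e : R) (u : nat -> H) : 0 <= e ->
  (forall n, \sum_(0 <= k < n) rnorm (u k) ^+ 2 <= e ^+ 2) ->
  exists2 x : ell2, ell2_fun x = u & rnorm x <= e.
Proof.
move=> e0 ue.
have nd : nondecreasing_seq (series (fun k => rnorm (u k) ^+ 2)).
  by apply: nondecreasing_series => k _ _; exact: sqr_ge0.
have uc : cvgn (series (fun k => rnorm (u k) ^+ 2)).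
  by apply: nondecreasing_is_cvgn => //; exists (e ^+ 2) => _ [n _ <-]; exact: ue.
have us : u \in square_summable by apply/square_summableP.
exists (Ell2 us) => //.
rewrite -ler_sqr ?nnegrE ?rnorm_ge0// ell2_rnorm_sq/=.
by apply: limr_le => //; near=> n; exact: ue.
Unshelve. all: by end_near. Qed.

Lemma rnorm_coord_le x k : rnorm (x k) <= rnorm x.
Proof.
rewrite -ler_sqr ?nnegrE ?rnorm_ge0// ell2_rnorm_sq.
apply: le_trans (ell2_partial_le x k.+1); rewrite big_nat_recr//=.
by rewrite lerDr sumr_ge0// => i _; exact: sqr_ge0.
Qed.

Lemma ell2_complete (F : set_system ell2) : ProperFilter F -> cauchy F -> cvg F.
Proof.
move=> FF Fc.
have small (e : R) : 0 < e -> exists2 A, F A &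
    forall x y, A x -> A y -> rnorm (x - y) < e.
  move=> e0; have e0' : (0 : R[i]) < e%:C by rewrite ltcR.
  have /cauchy_ballP/(_ _ e0') [[A B] /= [FA FB] AB] := Fc.
  exists (A `&` B); first exact: filterI.
  move=> x y [Ax _] [_ By]; rewrite -ltcR -rnormE.
  have := AB (x, y); rewrite -ball_normE; exact.
have coord k : cvg ((fun x : ell2 => x k) @ F).
  apply: cauchy_cvg; apply/cauchy_ballP => e e0.
  have eE : e = (complex.Re e)%:C by rewrite RRe_real// gtr0_real.
  have /small [A FA Ae] : 0 < complex.Re e by rewrite -ltcR -eE.
  exists ([set x k | x in A], [set x k | x in A]).
    by split; apply: (@filterS _ F _ A _ _ FA) => x Ax; exists x.
  move=> [_ _] /= [[x Ax <-] [y Ay <-]]; rewrite -ball_normE /= rnormE eE ltcR.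
  exact: le_lt_trans (rnorm_coord_le (x - y) k) (Ae _ _ Ax Ay).
pose y k : H := lim ((fun x : ell2 => x k) @ F).
have key (e : R) A : 0 < e -> F A ->
    (forall x y, A x -> A y -> rnorm (x - y) < e) -> forall x, A x ->
    forall n, \sum_(0 <= k < n) rnorm (x k - y k) ^+ 2 <= e ^+ 2.
  move=> e0 FA Ae x Ax n.
  have sc : (fun x' : ell2 => \sum_(0 <= k < n) rnorm (x k - x' k) ^+ 2) @ F
      --> \sum_(0 <= k < n) rnorm (x k - y k) ^+ 2.
    elim: n => [|n IHn].
      rewrite big_geq// (_ : (fun _ => _) = cst 0); first exact: cvg_cst.
      by apply/funext => x'; rewrite big_geq.
    rewrite big_nat_recr//= (_ : (fun _ => _) = (fun x' : ell2 =>
      \sum_(0 <= k < n) rnorm (x k - x' k) ^+ 2 + rnorm (x n - x' n) ^+ 2)).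
      apply: cvgD => //; rewrite expr2.
      have h : rnorm (x n - x' n) @[x' --> F] --> rnorm (x n - y n).
        by apply: rnorm_cvg; apply: cvgB; [exact: cvg_cst | exact: coord].
      exact: cvgM.
    by apply/funext => x'; rewrite big_nat_recr.
  rewrite -(cvg_lim _ sc)//; apply: limr_le; first by apply/cvg_ex; eexists; exact: sc.
  apply: filterS FA => x' Ax'.
  apply: le_trans (ell2_partial_le (x - x') n) _.
  rewrite -ell2_rnorm_sq ler_sqr ?nnegrE ?rnorm_ge0 ?(ltW e0)//.
  exact/ltW/Ae.
have [A1 FA1 Ae1] := small _ (@ltr01 R).
have [x1 Ax1] := filter_ex FA1.
have [d dE _] := rnorm_ell2_le (@ler01 R) (key _ _ ltr01 FA1 Ae1 _ Ax1).
apply/cvg_ex; exists (x1 - d); apply/cvgrPdist_le => e e0.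
have eE : e = (complex.Re e)%:C by rewrite RRe_real// gtr0_real.
have e0' : 0 < complex.Re e by rewrite -ltcR -eE.
have [A FA Ae] := small _ e0'.
apply: (filterS _ FA) => x Ax.
have [z zE ze] := rnorm_ell2_le (ltW e0') (key _ _ e0' FA Ae _ Ax).
rewrite (_ : x1 - d - x = - z) ?normrN ?rnormE ?[leRHS]eE ?lecR//.
apply/val_inj/funext => k /=.
rewrite -[LHS]/(x1 k - ell2_fun d k - x k) -[RHS]/(- ell2_fun z k) dE zE.
by rewrite subKr opprB.
Qed.

HB.instance Definition _ := Uniform_isComplete.Build ell2 ell2_complete.

End ell2_def.


HB.instance Definition _ (R : realType) := NormedModule.copy R[i] R[i]^o.

Section scalar_hilbert.
Context {R : realType}.

Lemma rnorm_scalar (z : R[i]) : rnorm z = Num.sqrt (complex.Re z ^+ 2 + complex.Im z ^+ 2).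
Proof. by rewrite /rnorm normc_def. Qed.

Lemma Re_rnorm_le (z : R[i]) : `|complex.Re z| <= rnorm z.
Proof.
by rewrite rnorm_scalar -sqrtr_sqr ler_wsqrtr// lerDl sqr_ge0.
Qed.

Lemma Im_rnorm_le (z : R[i]) : `|complex.Im z| <= rnorm z.
Proof.
by rewrite rnorm_scalar -sqrtr_sqr ler_wsqrtr// lerDr sqr_ge0.
Qed.

Lemma rnorm_scalar_le (z : R[i]) :
  rnorm z <= `|complex.Re z| + `|complex.Im z|.
Proof.
rewrite rnorm_scalar -[leRHS]ger0_norm ?addr_ge0// -sqrtr_sqr ler_wsqrtr//.
rewrite sqrrD !real_normK ?num_real// -addrA lerD2l addrC lerDl.
by rewrite mulrn_wge0// mulr_ge0.
Qed.

Lemma scalar_complete (F : set_system R[i]) :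
  ProperFilter F -> cauchy F -> cvg F.
Proof.
move=> FF Fc.
have small (e : R) : 0 < e -> exists2 A, F A &
    forall x y : R[i], A x -> A y -> rnorm (x - y) < e.
  move=> e0; have e0' : (0 : R[i]) < e%:C by rewrite ltcR.
  have /cauchy_ballP/(_ _ e0') [[A B] /= [FA FB] AB] := Fc.
  exists (A `&` B); first exact: filterI.
  move=> x y [Ax _] [_ By]; rewrite -ltcR -rnormE.
  have := AB (x, y); rewrite -ball_normE; exact.
have coord (p : R[i] -> R) : (forall x y, `|p x - p y| <= rnorm (x - y)) ->
    cvg (p @ F).
  move=> pl; apply: cauchy_cvg; apply/cauchy_ballP => e e0.
  have [A FA Ae] := small _ e0.
  exists ([set p x | x in A], [set p x | x in A]).
    by split; apply: (@filterS _ F _ A _ _ FA) => x Ax; exists x.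
  move=> [_ _] /= [[x Ax <-] [y Ay <-]]; rewrite -ball_normE /=.
  exact: le_lt_trans (pl _ _) (Ae _ _ Ax Ay).
have /cvg_ex[a Fa] : cvg ((@complex.Re R : R[i] -> R) @ F).
  by apply: coord => x y; rewrite -ReN -ReD; exact: Re_rnorm_le.
have /cvg_ex[b Fb] : cvg ((@complex.Im R : R[i] -> R) @ F).
  by apply: coord => x y; rewrite -ImN -ImD; exact: Im_rnorm_le.
apply/cvg_ex; exists (a +i* b); apply/cvgrPdist_lt => e e0.
have eE : e = (complex.Re e)%:C by rewrite RRe_real// gtr0_real.
have e0' : 0 < complex.Re e / 2 by rewrite divr_gt0// -ltcR -eE.
move/cvgrPdist_lt : Fa => /(_ _ e0') Fa.
move/cvgrPdist_lt : Fb => /(_ _ e0') Fb.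
apply: filterS2 Fa Fb => z az bz.
rewrite rnormE eE ltcR; apply: le_lt_trans (rnorm_scalar_le _) _.
by rewrite ReD ImD ReN ImN /= [ltRHS]splitr ltrD.
Qed.

HB.instance Definition _ := Uniform_isComplete.Build R[i] scalar_complete.

Definition scalar_inner (x y : R[i]) : R[i] := x * conjc y.

Lemma scalar_innerPl (a : R[i]) (x y z : R[i]) :
  scalar_inner (a *: x + y) z = a * scalar_inner x z + scalar_inner y z.
Proof. by rewrite /scalar_inner mulrDl -mulrA. Qed.

Lemma scalar_innerC (x y : R[i]) :
  scalar_inner y x = conjc (scalar_inner x y).
Proof. by rewrite /scalar_inner rmorphM/= conjcK mulrC. Qed.

Lemma scalar_inner_normE (x : R[i]) : scalar_inner x x = `|x| ^+ 2.
Proof. by rewrite /scalar_inner -sqr_normc. Qed.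

HB.instance Definition _ := @NormedModule_hasInner.Build R R[i]
  scalar_inner scalar_innerPl scalar_innerC scalar_inner_normE.

End scalar_hilbert.

(* [t x a] are the simple tensors of a Hilbert space tensor product [K] of [H] *)
(* and [L]; these properties determine [K] up to unitary equivalence.          *)
Definition is_hilbert_tensor (R : realType) (H L K : hilbertType R)
    (t : H -> L -> K) : Prop :=
  [/\ forall (c : R[i]) x y a, t (c *: x + y) a = c *: t x a + t y a,
      forall (c : R[i]) x a b, t x (c *: a + b) = c *: t x a + t x b,
      forall x y a b, inner (t x a) (t y b) = inner x y * inner a b &
      forall S : set K, S 0 ->
        (forall (c : R[i]) u v, S u -> S v -> S (c *: u + v)) ->
        (forall x a, S (t x a)) -> dense S].

Section ell2_tensor.
Context {R : realType} (H : hilbertType R).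

Lemma tensor_summable (x : H) (a : ell2 R[i]) :
  (fun k => (a k : R[i]) *: x) \in square_summable (H := H).
Proof.
apply/square_summableP.
rewrite (_ : (fun k => _) =
  (rnorm x ^+ 2) *: (fun k => rnorm (a k) ^+ 2 : R)); last first.
  by apply/funext => k; rewrite rnormZ exprMn mulrC.
exact/is_cvg_seriesZ/ell2_cvg.
Qed.

Definition tensor (x : H) (a : ell2 R[i]) : ell2 H :=
  Ell2 (tensor_summable x a).

Lemma tensorPl (c : R[i]) x y a :
  tensor (c *: x + y) a = c *: tensor x a + tensor y a.
Proof.
apply/val_inj/funext => k.
rewrite -[LHS]/((a k : R[i]) *: (c *: x + y)).
rewrite -[RHS]/(c *: ((a k : R[i]) *: x) + (a k : R[i]) *: y).
by rewrite scalerDr !scalerA mulrC.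
Qed.

Lemma tensorPr (c : R[i]) x a b :
  tensor x (c *: a + b) = c *: tensor x a + tensor x b.
Proof.
apply/val_inj/funext => k.
rewrite -[LHS]/((c * (a k : R[i]) + (b k : R[i])) *: x).
rewrite -[RHS]/(c *: ((a k : R[i]) *: x) + (b k : R[i]) *: x).
by rewrite scalerDl !scalerA.
Qed.

Lemma inner_tensor x y a b :
  inner (tensor x a) (tensor y b) = inner x y * inner a b.
Proof.
pose re : R^nat := fun k => complex.Re (inner (a k) (b k)).
pose im : R^nat := fun k => complex.Im (inner (a k) (b k)).
have cre : cvgn (series re) by exact: ell2_Re_cvg.
have cim : cvgn (series im) by exact: ell2_Im_cvg.
have cZ (u : R^nat) (c : R) : cvgn (series u) -> cvgn (series (c *: u)).
  exact: is_cvg_seriesZ.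
have tE k : inner (tensor x a k) (tensor y b k) =
    inner x y * inner (a k) (b k).
  rewrite -[LHS]/(inner ((a k : R[i]) *: x) ((b k : R[i]) *: y)).
  by rewrite innerZl innerZr mulrA mulrC.
have iE : inner a b = limn (series re) +i* limn (series im) by [].
rewrite -[LHS]/(ell2_inner (tensor x a) (tensor y b)) iE.
apply: complex_ext; rewrite ?(ReM, ImM) [LHS]/=.
  rewrite [X in series X](_ : _ = complex.Re (inner x y) *: re
     - complex.Im (inner x y) *: im); last first.
    by apply/funext => k; rewrite tE ReM.
  by rewrite (lim_seriesB (cZ _ _ cre) (cZ _ _ cim)) (lim_seriesZ _ cre)
    (lim_seriesZ _ cim).
rewrite [X in series X](_ : _ = complex.Re (inner x y) *: im
   + complex.Im (inner x y) *: re); last first.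
  by apply/funext => k; rewrite tE ImM.
by rewrite (lim_seriesD (cZ _ _ cim) (cZ _ _ cre)) (lim_seriesZ _ cre)
  (lim_seriesZ _ cim).
Qed.

Lemma ell2_delta_summable (n : nat) :
  (fun k => (k == n)%:R : R[i]) \in square_summable (H := R[i]).
Proof.
have h N : \sum_(0 <= k < N) rnorm ((k == n)%:R : R[i]) ^+ 2 <= 1 ^+ 2 :> R.
  have dE k : rnorm ((k == n)%:R : R[i]) ^+ 2 = (k == n)%:R :> R.
    rewrite rnorm_scalar; case: eqP => _ /=.
      by rewrite expr1n expr0n/= addr0 sqrtr1 expr1n.
    by rewrite expr0n/= addr0 sqrtr0 expr0n.
  under eq_bigr do rewrite dE.
  rewrite expr1n -natr_sum lern1.
  rewrite big_mkord; case: (ltnP n N) => nN.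
    rewrite (bigD1 (Ordinal nN))//= eqxx big1 ?addn0// => i.
    by rewrite -val_eqE /= => /negbTE ->.
  by rewrite big1// => i _; rewrite ltn_eqF// (leq_trans _ nN).
by have [x <- _] := rnorm_ell2_le (@ler01 R) h; exact: ell2_summable.
Qed.

Definition ell2_delta (n : nat) : ell2 R[i] := Ell2 (ell2_delta_summable n).

Definition ell2_trunc (z : ell2 H) (n : nat) : ell2 H :=
  \sum_(i < n) tensor (z i) (ell2_delta i).

Lemma ell2_truncE z n k : ell2_trunc z n k = if (k < n)%N then z k else 0.
Proof.
rewrite /ell2_trunc; elim: n => [|n IHn]; first by rewrite big_ord0.
rewrite big_ord_recr /= -[LHS]/((\sum_(i < n) tensor (z i) (ell2_delta i)) k
  + ((k == n)%:R : R[i]) *: z n) IHn ltnS.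
have [kn|nk|->] := ssrnat.ltngtP k n.
- by rewrite scale0r addr0.
- by rewrite scale0r addr0.
- by rewrite add0r scale1r.
Qed.

Lemma ell2_trunc_cvg z (e : R) : 0 < e ->
  exists n, rnorm (z - ell2_trunc z n) < e.
Proof.
move=> e0; pose s := series (fun k => rnorm (z k) ^+ 2).
have e20 : 0 < (e / 2) ^+ 2 by rewrite exprn_gt0// divr_gt0.
have /cvgrPdist_lt /(_ _ e20) [n _ /(_ n (leqnn n)) sn] := @ell2_cvg _ _ z.
exists n.
have bd N : \sum_(0 <= k < N) rnorm (z k - ell2_trunc z n k) ^+ 2
    <= (e / 2) ^+ 2.
  apply: le_trans (ltW (le_lt_trans (ler_norm _) sn)).
  rewrite lerBrDr.
  apply: le_trans (ell2_partial_le z (maxn N n)).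
  rewrite (big_cat_nat (n := n) _ (leq_maxr N n))//= [leRHS]addrC.
  rewrite /series/= lerD2r.
  apply: (@le_trans _ _ (\sum_(0 <= k < maxn N n)
    rnorm (z k - ell2_trunc z n k) ^+ 2)).
    rewrite [leRHS](big_cat_nat (n := N) _ (leq_maxl N n))//= lerDl sumr_ge0//.
    by move=> k _; exact: sqr_ge0.
  rewrite (big_cat_nat (n := n) _ (leq_maxr N n))//=.
  rewrite big_nat big1 ?add0r; last first.
    move=> k /andP[_ kn].
    by rewrite ell2_truncE kn subrr rnorm0 expr0n.
  rewrite big_nat [leRHS]big_nat; apply: ler_sum => k /andP[nk _].
  by rewrite ell2_truncE ltnNge nk subr0.
have e2 : 0 <= e / 2 by rewrite ltW// divr_gt0.
have [x xE xe] := rnorm_ell2_le e2 bd.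
rewrite (_ : z - ell2_trunc z n = x); last exact/val_inj/esym.
by apply: le_lt_trans xe _; rewrite ltr_pdivrMr// ltr_pMr// ltr1n.
Qed.

Lemma ell2_tensorP : is_hilbert_tensor tensor.
Proof.
split; [exact: tensorPl|exact: tensorPr|exact: inner_tensor|].
move=> S S0 Slin St O [z Oz] oO.
have /nbhs_ballP[e /= e0 zeO] : nbhs z O by exact: open_nbhs_nbhs.
have eE : e = (complex.Re e)%:C by rewrite RRe_real// gtr0_real.
have e0' : 0 < complex.Re e by rewrite -ltcR -eE.
have [n zn] := ell2_trunc_cvg z e0'.
exists (ell2_trunc z n); split.
  by apply: zeO; rewrite -ball_normE /= rnormE eE ltcR.
rewrite /ell2_trunc; elim: n {zn} => [|n IHn]; first by rewrite big_ord0.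
rewrite big_ord_recr/= addrC -[X in X + _]scale1r; exact: Slin.
Qed.

End ell2_tensor.

Record bounded_op (R : realType) (H : hilbertType R) := BoundedOp {
  bop_fun :> {linear H -> H} ;
  bop_continuous : continuous bop_fun
}.

Section ampliation.
Context {R : realType} {H : hilbertType R}.
Implicit Type A : bounded_op H.

Lemma bounded_op_rnorm A :
  exists2 M : R, 0 <= M & forall x, rnorm (A x) <= M * rnorm x.
Proof.
have /linear_bounded_continuous/linear_boundedP/pinfty_ex_gt0[M M0 AM] :=
  @bop_continuous _ _ A.
have ME : M = (complex.Re M)%:C by rewrite RRe_real// gtr0_real.
exists (complex.Re M); first by rewrite ltW// -ltcR -ME.
by move=> x; have := AM x; rewrite !rnormE ME -rmorphM lecR.
Qed.

Lemma ampl_summable A (x : ell2 H) :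
  (fun k => A (x k)) \in square_summable (H := H).
Proof.
have [M M0 AM] := bounded_op_rnorm A; apply/square_summableP.
apply: (@series_le_cvg _ _ (M ^+ 2 *: (fun k => rnorm (x k) ^+ 2))).
- by move=> n; exact: sqr_ge0.
- by move=> n; exact: (mulr_ge0 (sqr_ge0 _) (sqr_ge0 _)).
- move=> n; rewrite -[leRHS]/(M ^+ 2 * rnorm (x n) ^+ 2) -exprMn.
  by rewrite ler_sqr ?nnegrE ?mulr_ge0 ?rnorm_ge0 //; exact: AM.
- exact/is_cvg_seriesZ/ell2_cvg.
Qed.

(* [ampl A] is the operator [A (x) id]; see [ampl_tensor].                    *)
Definition ampl_fun A (x : ell2 H) : ell2 H := Ell2 (ampl_summable A x).

Lemma ampl_fun_linear A : linear (ampl_fun A).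
Proof.
by move=> a x y; apply/val_inj/funext => k; exact: (linearP A a (x k) (y k)).
Qed.

HB.instance Definition _ A := GRing.isLinear.Build R[i] (ell2 H) (ell2 H) _
  (ampl_fun A) (ampl_fun_linear A).

Lemma ampl_continuous A : continuous (ampl_fun A).
Proof.
have [M M0 AM] := bounded_op_rnorm A.
apply: bounded_linear_continuous; apply/bounded_funP => r.
exists (M%:C * r) => x xr.
apply: le_trans (_ : M%:C * `|x| <= _); last by rewrite ler_wpM2l// ler0c.
rewrite !rnormE -rmorphM lecR.
rewrite -ler_sqr ?nnegrE ?mulr_ge0 ?rnorm_ge0//.
rewrite exprMn !ell2_rnorm_sq -[leRHS]/(M ^+ 2 *: _).
rewrite -(lim_seriesZ _ (@ell2_cvg _ _ x)).
apply: lim_series_le.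
- exact: ell2_cvg.
- exact/is_cvg_seriesZ/ell2_cvg.
- move=> n; rewrite -[leRHS]/(M ^+ 2 * rnorm (x n) ^+ 2) -exprMn.
  by rewrite ler_sqr ?nnegrE ?mulr_ge0 ?rnorm_ge0 //; exact: AM.
Qed.

Definition ampl A : bounded_op (ell2 H) := BoundedOp (@ampl_continuous A).

Lemma ampl_tensor A x a : ampl A (tensor x a) = tensor (A x) a.
Proof. by apply/val_inj/funext => k; exact: (linearZ_LR A). Qed.

End ampliation.

Definition separable_space (T : topologicalType) : Prop :=
  exists2 D : set T, countable D & dense D.

Section operators.
Context {R : realType} {H : hilbertType R}.
Implicit Types A B U : bounded_op H.

Definition is_adjoint A B : Prop := forall x y, inner (A x) y = inner x (B y).

Definition unitary U : Prop :=
  exists W, [/\ is_adjoint U W, cancel U W & cancel W U].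

(* Extended-real valued, so that no junk value arises for unbounded [f]. *)
Definition opnorm (f : H -> H) : \bar R :=
  ereal_sup [set (rnorm (f x))%:E | x in [set x : H | `|x| <= 1]].

End operators.

Definition expi (R : realType) (t : R) : R[i] := cos t +i* sin t.

Section theta_commutation.
Context {R : realType} {d : nat}.
Implicit Type Theta : 'M[R]_d.

Definition antisymmetric_mx Theta : Prop := Theta^T = - Theta.

Definition phase_mx Theta : 'M[R[i]]_d :=
  \matrix_(k < d, l < d) expi (Theta k l).

Definition torus : set 'cV[R[i]]_d := [set z | forall k, `|z k 0| = 1].

Definition torus_subgroup (G : set 'cV[R[i]]_d) : Prop :=
  [/\ G `<=` torus,
      G (const_mx 1),
      forall u v, G u -> G v -> G (\col_k (u k 0 * v k 0)) &
      forall u, G u -> G (\col_k (u k 0)^-1)].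

Definition ergodic Theta : Prop :=
  torus `<=` closure (smallest torus_subgroup
                        [set col l (phase_mx Theta) | l in [set: 'I_d]]).

Context {H : hilbertType R}.
Implicit Types U V : 'I_d -> bounded_op H.

Definition unitary_tuple U : Prop := forall k, unitary (U k).

Definition theta_commuting Theta V : Prop :=
  forall k l x, V l (V k x) = expi (Theta k l) *: V k (V l x).

Definition almost_theta_commuting (delta : R) Theta U : Prop :=
  forall k l,
    (opnorm (fun x => U l (U k x) - expi (Theta k l) *: U k (U l x))%R
      <= delta%:E)%E.

Definition tuple_dist U V : \bar R :=
  \big[maxe/0%E]_(k < d) opnorm (fun x => U k x - V k x).

End theta_commutation.

(* Main.v *)
From HB Require Import structures.
Require Import Defs.
From mathcomp Require Import all_boot all_order all_algebra all_classical all_reals.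
From mathcomp Require Import topology ereal normedtype sequences trigo complex.
From mathcomp Require Import perm separable cyclic cyclotomic ring lra zify.

Import Order.TTheory GRing.Theory Num.Theory.
Import numFieldNormedType.Exports.

Local Open Scope classical_set_scope.
Local Open Scope ring_scope.
Local Open Scope complex_scope.

Set Implicit Arguments.
Unset Strict Implicit.
Unset Printing Implicit Defensive.

(* Write A = U (x) id and let B be the regular representation of the Weyl      *)
(* relations on H (x) l^2(Z^d) (x) l^2, an exactly Theta-commuting tuple; both *)
(* tuples are unitarily equivalent to their own double. It suffices to find    *)
(* isometries J and J' that approximately intertwine B with A and A with B:    *)
(* the range of J nearly reduces A, so A is close to B + A up to a unitary (a  *)
(* swindle inside the range of J absorbs one more copy of B); symmetrically B  *)
(* is close to A + B, and hence A is close to a unitary conjugate of B.        *)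
(*   Both isometries average over a box of side N in Z^d: if the Xi_r are      *)
(* isometries with orthogonal ranges and A_k Xi_r is close to p Xi_(r + e_k),  *)
(* with the phase p produced by moving a letter to its place in an ordered     *)
(* monomial X_r, then N^(-d/2) sum_r Xi_r X_r^* is nearly intertwining, up to  *)
(* a boundary term of norm O(N^(-1/2)). For J', Xi_r = X_r(B) delta_0. For J,  *)
(* one needs orthogonal translates inside A: ergodicity supplies, for every    *)
(* character a of (Z/N)^d, a unitary W_a (a word in U) conjugating A_k         *)
(* approximately to a scalar multiple given by a, and Xi_r is the sum over a   *)
(* of a(r) W_a X_r(A) put in orthogonal copies of the space: orthogonality of  *)
(* the Xi_r is then the orthogonality of characters.                           *)

(** This plan is carried out with explicit tolerances. [uni_of_embeddings] is an approximate
    Schroeder-Bernstein argument: two unitary tuples that embed in each other by nearly intertwining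
    isometries, and that each contain two exact copies of themselves as a full splitting, are nearly
    unitarily equivalent, with a loss of a factor 10. So it suffices to embed [A], the amplification
    of [U], and the exact tuple [B] of [twisted_shift] in each other; the answer is then
    [V k = dag Phi (B k) Phi].

    Both embeddings come from [spread], an averaging over a box of the lattice. It needs the same
    phases to govern words in [A] and words in [B], which is why [word_shift] extracts them from
    [Theta] alone. Inside [B] the required orthogonal ranges are the lattice sites ([embed_exact]).
    Inside [A] they have to be made ([embed_almost]): the rescalings of [A] that are approximately
    implemented by unitaries form a group containing the columns of the phase matrix, so ergodicity
    reaches every point of the torus ([ergodic_implement]), in particular all tuples of roots of
    unity, and character orthogonality ([box_char_orth]) does the rest.

    The order of choices is the box side, then the tolerance [eta], then the constants of the
    embeddings, then [delta]. None of them depends on the Hilbert space or on [U]. *)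

Section real_inner.
Context {R : realType} {H : hilbertType R}.
Implicit Types x y : H.

Lemma Re_inner_self x : complex.Re (inner x x) = rnorm x ^+ 2.
Proof. by rewrite inner_rnormE. Qed.

Lemma Re_inner_le_rnorm x y : complex.Re (inner x y) <= rnorm x * rnorm y.
Proof.
have : rnorm (x + y) ^+ 2 <= (rnorm x + rnorm y) ^+ 2.
  by rewrite ler_sqr ?nnegrE ?addr_ge0 ?rnorm_ge0 ?rnormD.
rewrite rnorm_sqrD sqrrD => h; lra.
Qed.

Lemma inner_ext x y : (forall z, inner x z = inner y z) -> x = y.
Proof.
move=> h; apply/eqP; rewrite -subr_eq0; apply/eqP/rnorm_eq0/eqP.
rewrite -sqrf_eq0 -Re_inner_self innerDl innerNl; apply/eqP.
by rewrite h subrr.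
Qed.

Lemma rnormB_le x y : rnorm (x - y) <= rnorm x + rnorm y.
Proof. by rewrite -(rnormN y) rnormD. Qed.

Lemma rnorm_sum (I : Type) (r : seq I) (P : pred I) (F : I -> H) :
  rnorm (\sum_(i <- r | P i) F i) <= \sum_(i <- r | P i) rnorm (F i).
Proof.
elim/big_rec2: _ => [|i x y _ h]; first by rewrite rnorm0.
by apply: le_trans (rnormD _ _) _; rewrite lerD2l.
Qed.

Lemma rnorm_unit (c : R[i]) x : `|c| = 1 -> rnorm (c *: x) = rnorm x.
Proof. by move=> c1; rewrite rnormZ c1 mul1r. Qed.

Lemma rnorm_scaleR (c : R) x : 0 <= c -> rnorm (c%:C *: x) = c * rnorm x.
Proof. by move=> c0; rewrite rnormZ ger0_norm ?ler0c. Qed.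

End real_inner.

Lemma conjcMl (R : realType) (c : R[i]) : `|c| = 1 -> conjc c * c = 1.
Proof. by move=> c1; rewrite mulrC -sqr_normc c1 expr1n. Qed.

Lemma conjcMr (R : realType) (c : R[i]) : `|c| = 1 -> c * conjc c = 1.
Proof. by move=> c1; rewrite mulrC conjcMl. Qed.

Lemma norm_conjc (R : realType) (c : R[i]) : `|conjc c| = `|c|.
Proof. by case: c => a b; rewrite !normc_def /= sqrrN. Qed.

(** * Operators carrying their adjoint *)

Section op.
Context {R : realType}.

(** Having the adjoint as data makes linearity automatic and lets adjoints of sums and composites be
    computed by definition. Continuity is recovered for isometries in [bounded_of_op]. *)
Record op (H K : hilbertType R) := Op {
  op_fun :> H -> K ;
  op_dag : K -> H ;
  op_adj : forall x y, inner (op_fun x) y = inner x (op_dag y) }.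

Lemma op_is_linear (H K : hilbertType R) (T : op H K) : linear T.
Proof.
move=> a x y; apply: inner_ext => z.
by rewrite op_adj !innerPl !op_adj.
Qed.

HB.instance Definition _ (H K : hilbertType R) (T : op H K) :=
  GRing.isLinear.Build R[i] H K *:%R (op_fun T) (op_is_linear T).

Lemma opD (H K : hilbertType R) (T : op H K) x y : T (x + y) = T x + T y.
Proof. exact: linearD. Qed.

Lemma opB (H K : hilbertType R) (T : op H K) x y : T (x - y) = T x - T y.
Proof. exact: linearB. Qed.

Lemma opZ (H K : hilbertType R) (T : op H K) c x : T (c *: x) = c *: T x.
Proof. exact: linearZ. Qed.

Lemma op0 (H K : hilbertType R) (T : op H K) : T 0 = 0.
Proof. exact: linear0. Qed.

Lemma op_sum (H K : hilbertType R) (T : op H K) (I : Type) (r : seq I)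
  (P : pred I) (F : I -> H) :
  T (\sum_(i <- r | P i) F i) = \sum_(i <- r | P i) T (F i).
Proof. exact: linear_sum. Qed.

Lemma dag_subproof (H K : hilbertType R) (T : op H K) x y :
  inner (op_dag T x) y = inner x (T y).
Proof. by rewrite innerC -op_adj -innerC. Qed.

Definition dag (H K : hilbertType R) (T : op H K) : op K H :=
  Op (dag_subproof T).

Lemma dagP (H K : hilbertType R) (T : op H K) x y :
  inner (T x) y = inner x (dag T y).
Proof. exact: op_adj. Qed.

Lemma dagP' (H K : hilbertType R) (T : op H K) x y :
  inner (dag T x) y = inner x (T y).
Proof. exact: op_adj. Qed.

Lemma comp_subproof (H K L : hilbertType R) (S : op K L) (T : op H K) x y :
  inner (S (T x)) y = inner x (dag T (dag S y)).
Proof. by rewrite !dagP. Qed.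

Definition ocomp (H K L : hilbertType R) (S : op K L) (T : op H K) : op H L :=
  Op (comp_subproof S T).

Lemma oid_subproof (H : hilbertType R) (x y : H) : inner x y = inner x y.
Proof. by []. Qed.

Definition oid (H : hilbertType R) : op H H := Op (@oid_subproof H).

Lemma oadd_subproof (H K : hilbertType R) (S T : op H K) x y :
  inner (S x + T x) y = inner x (dag S y + dag T y).
Proof. by rewrite innerDl innerDr !dagP. Qed.

Definition oadd (H K : hilbertType R) (S T : op H K) : op H K :=
  Op (oadd_subproof S T).

Lemma oscale_subproof (H K : hilbertType R) c (T : op H K) x y :
  inner (c *: T x) y = inner x (conjc c *: dag T y).
Proof. by rewrite innerZl innerZr conjcK dagP. Qed.

Definition oscale (H K : hilbertType R) c (T : op H K) : op H K :=
  Op (oscale_subproof c T).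

Lemma osum_subproof (H K : hilbertType R) (I : finType) (T : I -> op H K) x y :
  inner (\sum_i T i x) y = inner x (\sum_i dag (T i) y).
Proof.
elim/big_rec2: _ => [|i u v _ h]; first by rewrite inner0l inner0r.
by rewrite innerDl innerDr h dagP.
Qed.

Definition osum (H K : hilbertType R) (I : finType) (T : I -> op H K) :
  op H K := Op (osum_subproof T).

Lemma oaddE (H K : hilbertType R) (S T : op H K) x :
  oadd S T x = S x + T x.
Proof. by []. Qed.

Lemma dag_oadd (H K : hilbertType R) (S T : op H K) x :
  dag (oadd S T) x = dag S x + dag T x.
Proof. by []. Qed.

Lemma oscaleE (H K : hilbertType R) c (T : op H K) x :
  oscale c T x = c *: T x.
Proof. by []. Qed.

Lemma dag_oscale (H K : hilbertType R) c (T : op H K) x :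
  dag (oscale c T) x = conjc c *: dag T x.
Proof. by []. Qed.

Lemma osumE (H K : hilbertType R) (I : finType) (T : I -> op H K) x :
  osum T x = \sum_i T i x.
Proof. by []. Qed.

Lemma dag_osum (H K : hilbertType R) (I : finType) (T : I -> op H K) x :
  dag (osum T) x = \sum_i dag (T i) x.
Proof. by []. Qed.

Lemma dagK (H K : hilbertType R) (T : op H K) x : dag (dag T) x = T x.
Proof. by []. Qed.

Definition iso (H K : hilbertType R) (T : op H K) : Prop := cancel T (dag T).

Definition uni (H K : hilbertType R) (T : op H K) : Prop :=
  iso T /\ iso (dag T).

Lemma uni_dag (H K : hilbertType R) (T : op H K) : uni T -> uni (dag T).
Proof. by case. Qed.

Lemma iso_comp (H K L : hilbertType R) (S : op K L) (T : op H K) :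
  iso S -> iso T -> iso (ocomp S T).
Proof. by move=> sS sT x; rewrite -[LHS]/(dag T (dag S (S (T x)))) sS sT. Qed.

Lemma uni_comp (H K L : hilbertType R) (S : op K L) (T : op H K) :
  uni S -> uni T -> uni (ocomp S T).
Proof.
move=> [S1 S2] [T1 T2]; split; first exact: iso_comp.
exact: (iso_comp T2 S2).
Qed.

Lemma iso_inner (H K : hilbertType R) (T : op H K) x y :
  iso T -> inner (T x) (T y) = inner x y.
Proof. by move=> sT; rewrite dagP sT. Qed.

Lemma iso_rnorm (H K : hilbertType R) (T : op H K) x :
  iso T -> rnorm (T x) = rnorm x.
Proof.
move=> sT; apply/eqP; rewrite -(@eqrXn2 _ 2) ?rnorm_ge0 //.
by rewrite -!Re_inner_self iso_inner.
Qed.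

Lemma iso_dag_rnorm (H K : hilbertType R) (T : op H K) x :
  iso T -> rnorm (dag T x) <= rnorm x.
Proof.
move=> sT; have [->|x0] := eqVneq (rnorm (dag T x)) 0; first exact: rnorm_ge0.
have dx0 : 0 < rnorm (dag T x) by rewrite lt_neqAle eq_sym x0 rnorm_ge0.
rewrite -(ler_pM2r dx0) -expr2 -Re_inner_self dagP'.
apply: le_trans (Re_inner_le_rnorm _ _) _.
by rewrite iso_rnorm.
Qed.

End op.

(** * Approximate intertwiners and the swindle *)

Section intertwining.
Context {R : realType} {d : nat}.
Implicit Types H K L : hilbertType R.

Definition intertw (e : R) H K (T : op H K)
    (A : 'I_d -> op H H) (B : 'I_d -> op K K) : Prop :=
  forall k x, rnorm (T (A k x) - B k (T x)) <= e * rnorm x.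

(** If [y] is the defect of [dag T] at [x], then [|y|^2] is the inner product of [x] with
    [B^* T y - T A^* y]. Applying the isometry [B] turns the latter into the defect of [T] at
    [A^* y], a vector of the norm of [y]. *)
Lemma intertw_dag (e : R) H K (T : op H K) A B : 0 <= e ->
  (forall k, uni (A k)) -> (forall k, uni (B k)) ->
  intertw e T A B -> intertw e (dag T) B A.
Proof.
move=> e0 uA uB TAB k x; set y := _ - _.
have [->|y0] := eqVneq (rnorm y) 0; first by rewrite mulr_ge0 ?rnorm_ge0.
have {}y0 : 0 < rnorm y by rewrite lt_neqAle eq_sym y0 rnorm_ge0.
have [[uA1 uA2] [uB1 uB2]] := (uA k, uB k).
rewrite -(ler_pM2r y0) -expr2 -Re_inner_self {1}/y innerDl innerNl.
rewrite dagP' dagP [inner (A k _) _]dagP dagP' -innerNr -innerDr.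
apply: le_trans (Re_inner_le_rnorm _ _) _.
rewrite mulrAC mulrC ler_wpM2r ?rnorm_ge0 //.
rewrite -(iso_rnorm _ uB1) opB [B k (dag _ _)]uB2.
have := TAB k (dag (A k) y); rewrite (iso_rnorm _ uA2).
by rewrite [A k (dag _ _)]uA2.
Qed.

Lemma intertw_comp (e f : R) H K L (S : op K L) (T : op H K) A B C :
  (forall x, rnorm (S x) <= rnorm x) -> (forall x, rnorm (T x) <= rnorm x) ->
  0 <= f -> intertw e T A B -> intertw f S B C ->
  intertw (e + f) (ocomp S T) A C.
Proof.
move=> cS cT f0 hT hS k x.
rewrite -[X in rnorm X]/(S (T (A k x)) - C k (S (T x))).
rewrite -[X in rnorm X](subrKA (S (B k (T x)))) -opB.
apply: le_trans (rnormD _ _) _; rewrite mulrDl lerD //.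
  exact: le_trans (cS _) _.
by apply: le_trans (hS _ _) _; rewrite ler_wpM2l.
Qed.

Lemma intertw_add (e f : R) H K (S T : op H K) A B :
  intertw e S A B -> intertw f T A B -> intertw (e + f) (oadd S T) A B.
Proof.
move=> hS hT k x; rewrite !oaddE opD opprD addrACA mulrDl.
exact: le_trans (rnormD _ _) (lerD _ _).
Qed.

Definition splits H K L (s0 : op K H) (s1 : op L H) : Prop :=
  [/\ iso s0, iso s1, forall x, dag s0 (s1 x) = 0 &
      forall x, s0 (dag s0 x) + s1 (dag s1 x) = x].

Lemma splits_orth H K L (s0 : op K H) (s1 : op L H) x :
  splits s0 s1 -> dag s1 (s0 x) = 0.
Proof.
case=> i0 i1 z _; apply: inner_ext => y.
by rewrite inner0l dagP' dagP z inner0r.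
Qed.

(** The splittings read [K = H + K] and [H = K + H]; the operator is the flip of the two
    summands. *)
Lemma uni_swap H K (s0 : op H K) (s1 : op K K) (t0 : op K H) (t1 : op H H) :
  splits s0 s1 -> splits t0 t1 ->
  uni (oadd (ocomp t0 (dag s1)) (ocomp t1 (dag s0))).
Proof.
have cycl H' K' (u0 : op H' K') (u1 : op K' K') (v0 : op K' H')
    (v1 : op H' H') : splits u0 u1 -> splits v0 v1 -> forall x,
    u1 (dag v0 (v0 (dag u1 x) + v1 (dag u0 x))) +
    u0 (dag v1 (v0 (dag u1 x) + v1 (dag u0 x))) = x.
  move=> hu hv x; have vo := splits_orth _ hv.
  case: hu hv => [_ _ _ uE] [v0i v1i vz _].
  by rewrite !opD v0i v1i vz vo !op0 addr0 add0r addrC uE.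
move=> hs ht; split=> x; first exact: cycl hs ht x.
have := cycl _ _ t0 t1 s0 s1 ht hs x.
rewrite addrC => h; rewrite -[RHS]h.
congr (t0 (dag s1 _) + t1 (dag s0 _)); exact: addrC.
Qed.

(* [s1] acts as [t1] on the range of [J] and as the identity off it, so that   *)
(* [s0 = J t0] and [s1] identify [H + K] with [K].                             *)
Lemma absorb (e : R) H K (J : op H K) (t0 t1 : op H H) A B : 0 <= e ->
  (forall k, uni (A k)) -> (forall k, uni (B k)) ->
  iso J -> intertw e J B A -> splits t0 t1 ->
  (forall k x, t0 (B k x) = B k (t0 x)) ->
  (forall k x, t1 (B k x) = B k (t1 x)) ->
  exists s0 s1, [/\ splits s0 s1, intertw e s0 B A & intertw (4 * e) s1 A A].
Proof.
move=> e0 uA uB iJ hJ ht tB0 tB1.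
have to := splits_orth _ ht; case: ht => [i0 i1 tz tE].
pose s1 := oadd (ocomp J (ocomp t1 (dag J)))
  (oadd (oid K) (oscale (- 1) (ocomp J (dag J)))).
have s1E x : s1 x = J (t1 (dag J x)) + (x - J (dag J x)).
  by rewrite /s1 !oaddE oscaleE scaleN1r.
have ds1E x : dag s1 x = J (dag t1 (dag J x)) + (x - J (dag J x)).
  rewrite /s1 !dag_oadd dag_oscale.
  by rewrite rmorphN rmorph1 scaleN1r.
clearbody s1; have JdJ x : dag J (s1 x) = t1 (dag J x).
  by rewrite s1E opD opB !iJ subrr addr0.
have JdJ' x : dag J (dag s1 x) = dag t1 (dag J x).
  by rewrite ds1E opD opB !iJ subrr addr0.
exists (ocomp J t0), s1; split.
- split.
  + exact: iso_comp.
  + move=> x; rewrite ds1E JdJ i1 s1E.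
    by rewrite [J (t1 _) + _]addrC addrK addrC subrK.
  + by move=> x; rewrite -[LHS]/(dag t0 (dag J (s1 x))) JdJ tz.
  + move=> x; rewrite -[X in X + _]/(J (t0 (dag t0 (dag J x)))).
    rewrite s1E JdJ' addrA -opD tE.
    by rewrite ds1E [J (dag t1 _) + _]addrC addrK addrC subrK.
- move=> k x; rewrite -[X in rnorm X]/(J (t0 (B k x)) - A k (J (t0 x))) tB0.
  by have := hJ k (t0 x); rewrite (iso_rnorm _ i0).
- have hdJ := intertw_dag e0 uB uA hJ.
  move=> k x; rewrite !s1E opD opB.
  (* Four defects, two of [dag J] and two of [J], each of size at most [e * rnorm x]; hence the
     constant 4. *)
  rewrite (_ : _ - _ = J (t1 (dag J (A k x) - B k (dag J x)))
     + (J (B k (t1 (dag J x))) - A k (J (t1 (dag J x))))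
     - J (dag J (A k x) - B k (dag J x))
     - (J (B k (dag J x)) - A k (J (dag J x)))); last first.
    rewrite !opB -tB1 subrKA -[RHS]addrA -opprD subrKA opprB.
    by rewrite opprD addrACA opprB [X in _ + X]addrC subrKA.
  apply: le_trans (rnormB_le _ _) _.
  apply: le_trans (lerD (rnormB_le _ _) (hJ _ _)) _.
  apply: le_trans (lerD (lerD (rnormD _ _) (lexx _)) (lexx _)) _.
  have h1 := hdJ k x; have h2 := hJ k (t1 (dag J x)).
  have h3 : e * rnorm (dag J x) <= e * rnorm x.
    by rewrite ler_wpM2l // iso_dag_rnorm.
  rewrite !(iso_rnorm _ iJ) !(iso_rnorm _ i1) in h2 *.
  lra.
Qed.

(** By [absorb], [A] is close to [B + A] and [B] is close to [A + B]; flipping the summands compares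
    [A] with [B]. *)
Lemma uni_of_embeddings (e : R) H K (J : op H K) (J' : op K H)
    (t0 t1 : op H H) (u0 u1 : op K K) A B : 0 <= e ->
  (forall k, uni (A k)) -> (forall k, uni (B k)) ->
  iso J -> intertw e J B A -> iso J' -> intertw e J' A B ->
  splits t0 t1 -> (forall k x, t0 (B k x) = B k (t0 x)) ->
  (forall k x, t1 (B k x) = B k (t1 x)) ->
  splits u0 u1 -> (forall k x, u0 (A k x) = A k (u0 x)) ->
  (forall k x, u1 (A k x) = A k (u1 x)) ->
  exists2 Phi : op K H, uni Phi & intertw (10 * e) Phi A B.
Proof.
move=> e0 uA uB iJ hJ iJ' hJ' ht tB0 tB1 hu uA0 uA1.
have [s0 [s1 [hs hs0 hs1]]] := absorb e0 uA uB iJ hJ ht tB0 tB1.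
have [r0 [r1 [hr hr0 hr1]]] := absorb e0 uB uA iJ' hJ' hu uA0 uA1.
exists (oadd (ocomp r0 (dag s1)) (ocomp r1 (dag s0))); first exact: uni_swap.
have e4 : 0 <= 4 * e by rewrite mulr_ge0.
have [is0 is1 _ _] := hs; have [ir0 ir1 _ _] := hr.
(* Each of the two summands of the flip composes one isometry of defect [e] with one of defect
   [4 * e]. *)
rewrite (_ : 10 * e = (4 * e + e) + (e + 4 * e)); last by ring.
have ctr H' K' (S : op H' K') : iso S -> forall x, rnorm (S x) <= rnorm x.
  by move=> iS x; rewrite iso_rnorm.
have dctr H' K' (S : op H' K') : iso S -> forall x, rnorm (dag S x) <= rnorm x.
  by move=> iS x; exact: iso_dag_rnorm.
apply: intertw_add.
  exact: intertw_comp (ctr _ _ _ ir0) (dctr _ _ _ is1) e0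
    (intertw_dag e4 uA uA hs1) hr0.
exact: intertw_comp (ctr _ _ _ ir1) (dctr _ _ _ is0) e4
  (intertw_dag e0 uB uA hs0) hr1.
Qed.

End intertwining.

(** * Averaging over a box of side [n.+1] *)

Section box.
Context {d n : nat}.

Definition box := {ffun 'I_d -> 'I_n.+1}.
Implicit Types (r : box) (k : 'I_d).

(** The shift is cyclic so that it permutes the box and sums can be reindexed along it. It is the
    true translation except on the face [r k = ord_max]. *)
Definition box_shift k r : box :=
  [ffun j => if j == k then ordS (r j) else r j].

Lemma box_shift_inj k : injective (box_shift k).
Proof.
move=> r r' /ffunP h; apply/ffunP => j; have := h j; rewrite !ffunE.
by case: eqP => // _; exact: ordS_inj.
Qed.

(** Transposing [j] and [ord_max] in coordinate [k] permutes the box, so all [n.+1] slices have the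
    same size. This proportion produces the boundary term of [spread]. *)
Lemma card_box_face k :
  (#|[pred r : box | r k == ord_max]| * n.+1 = #|{: box}|)%N.
Proof.
pose sw (j : 'I_n.+1) r : box :=
  [ffun i => if i == k then tperm j ord_max (r i) else r i].
have sw_inj j : injective (sw j).
  move=> r r' /ffunP h; apply/ffunP => i; have := h i; rewrite !ffunE.
  by case: eqP => // _; exact: perm_inj.
rewrite -[RHS]sum1_card (partition_big (fun r => r k) predT) //=.
rewrite (eq_bigr (fun=> #|[pred r : box | r k == ord_max]|)) => [|j _].
  by rewrite sum_nat_const card_ord mulnC.
rewrite -sum1_card (reindex_inj (@sw_inj j)) /=; apply: eq_bigl => r.
rewrite inE ffunE eqxx; apply/eqP/eqP => [h|->]; last by rewrite tpermR.
by rewrite -(tpermK j ord_max (r k)) h tpermL.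
Qed.

Lemma card_box_ge1 (R : realType) : 1 <= #|{: box}|%:R :> R.
Proof. by rewrite ler1n; apply/card_gt0P; exists [ffun=> ord0]. Qed.

End box.
Arguments box : clear implicits.

Lemma inv_sqrt_bounds (R : realType) (N : R) (c := (Num.sqrt N)^-1) : 1 <= N ->
  [/\ 0 <= c, c <= 1 & c ^+ 2 * N = 1].
Proof.
move=> N1; have N0 : 0 < N by apply: lt_le_trans N1.
split; first by rewrite invr_ge0 sqrtr_ge0.
  by rewrite /c invf_le1 ?sqrtr_gt0 // -[leLHS]sqrtr1 ler_sqrt // ltW.
by rewrite exprVn sqr_sqrtr ?(ltW N0) // mulVf // gt_eqF.
Qed.

Section spread.
Context {R : realType} {d n : nat}.
Implicit Types H K M : hilbertType R.

Lemma inner_suml H (I : finType) (P : pred I) (F : I -> H) y :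
  inner (\sum_(i | P i) F i) y = \sum_(i | P i) inner (F i) y.
Proof.
by elim/big_rec2: _ => [|i u v _ h]; rewrite ?inner0l // innerDl h.
Qed.

Lemma rnorm_orth_sum H K (I : finType) (P : pred I) (T : I -> op H K) x :
  (forall i, iso (T i)) ->
  (forall i j y, i != j -> dag (T i) (T j y) = 0) ->
  rnorm (\sum_(i | P i) T i x) ^+ 2 = #|P|%:R * rnorm x ^+ 2.
Proof.
move=> iT oT; apply: complexI; rewrite [RHS]rmorphM rmorph_nat -!inner_rnormE.
rewrite inner_suml mulr_natl -sumr_const; apply: eq_bigr => i Pi.
rewrite -[RHS]/((rnorm x ^+ 2)%:C) -inner_rnormE.
rewrite dagP op_sum (bigD1 i) // iT big1 => [|j /andP[_ ji]].
  by rewrite /= addr0.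
by rewrite oT // eq_sym.
Qed.

Lemma rnorm_orth_sum_le H K (I : finType) (P : pred I) (T : I -> op H K)
    (c : R) x : 0 <= c ->
  (forall i, iso (T i)) ->
  (forall i j y, i != j -> dag (T i) (T j y) = 0) ->
  #|P|%:R <= c ^+ 2 ->
  rnorm (\sum_(i | P i) T i x) <= c * rnorm x.
Proof.
move=> c0 iT oT Pc; rewrite -ler_sqr ?nnegrE ?mulr_ge0 ?rnorm_ge0 //.
by rewrite rnorm_orth_sum // exprMn ler_wpM2r ?sqr_ge0.
Qed.

(** [J] is the sum of [Xi r (dag (X r))] divided by the square root of the box size: orthogonal
    ranges make it an isometry. Away from the face the phases [p] cancel, since [dag (X r)] absorbs
    one and [Xi r] emits the same one. On the face there are two sums of orthogonal isometries, and
    Pythagoras bounds each, after normalization, by [1 / Num.sqrt n.+1%:R]. *)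
Lemma spread (M K : hilbertType R) (D : 'I_d -> op M M) (A : 'I_d -> op K K)
    (Xi : box d n -> op M K) (X : box d n -> op M M)
    (p : 'I_d -> box d n -> R[i]) (eta1 eta2 : R) : 0 <= eta1 -> 0 <= eta2 ->
  (forall k, uni (D k)) -> (forall k, uni (A k)) ->
  (forall r, iso (Xi r)) ->
  (forall r r' x, r != r' -> dag (Xi r) (Xi r' x) = 0) ->
  (forall r, uni (X r)) ->
  (forall k (r : box d n) x, r k != ord_max ->
    rnorm (A k (Xi r x) - p k r *: Xi (box_shift k r) x) <= eta1 * rnorm x) ->
  (forall k (r : box d n) x, r k != ord_max ->
    rnorm (D k (X r x) - p k r *: X (box_shift k r) x) <= eta2 * rnorm x) ->
  exists2 J : op M K, iso J &
    intertw (#|{: box d n}|%:R * (eta1 + eta2) + 2 / Num.sqrt n.+1%:R) J D A.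
Proof.
move=> eta1_ge0 eta2_ge0 uD uA iXi oXi uX hXi hX.
pose N : R := #|{: box d n}|%:R; pose c : R := (Num.sqrt N)^-1.
have N1 : 1 <= N by exact: card_box_ge1.
have N0 : 0 < N by apply: lt_le_trans N1.
have [c0 c1 c2] := inv_sqrt_bounds N1.
pose T r := ocomp (Xi r) (dag (X r)).
have iT r : iso (T r) by apply: iso_comp => //; case: (uX r).
have oT r r' x : r != r' -> dag (T r) (T r' x) = 0.
  move=> rr'; rewrite -[LHS]/(X r (dag (Xi r) (Xi r' (dag (X r') x)))).
  by rewrite oXi // op0.
exists (oscale c%:C (osum T)).
  move=> x; rewrite dag_oscale dag_osum oscaleE osumE.
  transitivity ((conjc c%:C * c%:C) *: (\sum_(i : box d n) x)).
    rewrite -scalerA; congr (_ *: _); rewrite [RHS]scaler_sumr; apply: eq_bigr => r _.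
    rewrite opZ op_sum (bigD1 r) // iT big1 => [|r' rr'].
      by rewrite /= addr0.
    by rewrite oT // eq_sym.
  rewrite sumr_const -scaler_nat scalerA conjc_real -rmorphM /=.
  by rewrite -[_%:R](rmorph_nat (real_complex R)) -rmorphM -expr2 c2 scale1r.
move=> k x; rewrite !oscaleE !osumE opZ -scalerBr op_sum.
(* The term of [J (D k x)] at the shifted index is paired with the term of [A k (J x)] at [r]. *)
rewrite rnorm_scaleR // (reindex_inj (@box_shift_inj _ _ k)) /= -sumrB.
rewrite (bigID (fun r : box d n => r k == ord_max)) /= sumrB.
set good := \sum_(i | _ != _) _.
set bad1 := \sum_(i | _) _; set bad2 := \sum_(i | _) A k _.
have cN : c * Num.sqrt (N / n.+1%:R) = (Num.sqrt n.+1%:R)^-1.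
  by rewrite sqrtrM ?(ltW N0) // mulrA mulVf ?mul1r ?sqrtrV ?ler0n //
    gt_eqF // sqrtr_gt0.
have card_bad : #|[pred r : box d n | r k == ord_max]|%:R
    <= Num.sqrt (N / n.+1%:R) ^+ 2.
  rewrite sqr_sqrtr ?divr_ge0 ?(ltW N0) //.
  by rewrite ler_pdivlMr ?ltr0n // -natrM card_box_face.
have sN0 : 0 <= Num.sqrt (N / n.+1%:R) by exact: sqrtr_ge0.
have hb1 : rnorm bad1 <= Num.sqrt (N / n.+1%:R) * rnorm x.
  have [iD _] := uD k; rewrite -(iso_rnorm x iD).
  apply: (@rnorm_orth_sum_le _ _ _ _ (fun r => T (box_shift k r))) => //.
  by move=> i j y ij; rewrite oT // (inj_eq (@box_shift_inj _ _ k)).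
have hb2 : rnorm bad2 <= Num.sqrt (N / n.+1%:R) * rnorm x.
  have [iA _] := uA k; rewrite /bad2 -op_sum (iso_rnorm _ iA).
  exact: (@rnorm_orth_sum_le _ _ _ _ T).
have hg : rnorm good <= N * (eta1 + eta2) * rnorm x.
  apply: le_trans (rnorm_sum _ _ _) _.
  apply: (@le_trans _ _ (\sum_(r : box d n) (eta1 + eta2) * rnorm x)); last first.
    by rewrite sumr_const -mulr_natl mulrA.
  rewrite big_mkcond /=; apply: ler_sum => r _; case: ifP => rk; last first.
    by rewrite mulr_ge0 ?addr_ge0 ?rnorm_ge0.
  have [uX1 uX2] := uX r; have [uX1' uX2'] := uX (box_shift k r).
  pose y := dag (X r) x; have xE : x = X r y by rewrite [X r _]uX2.
  have yE : rnorm y = rnorm x by rewrite (iso_rnorm _ uX2).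
  rewrite -[X in rnorm X]/(Xi (box_shift k r) (dag (X (box_shift k r)) (D k x))
    - A k (Xi r y)).
  rewrite (_ : _ - _ =
    Xi (box_shift k r) (dag (X (box_shift k r))
      (D k (X r y) - p k r *: X (box_shift k r) y))
    - (A k (Xi r y) - p k r *: Xi (box_shift k r) y)); last first.
    by rewrite -xE !opB !opZ uX1' opprB subrKA.
  apply: le_trans (rnormB_le _ _) _.
  rewrite (iso_rnorm _ (iXi _)) (iso_rnorm _ uX2') addrC mulrDl -yE.
  by rewrite lerD ?hX ?hXi.
apply: (@le_trans _ _ (c * (N * (eta1 + eta2) * rnorm x +
  (Num.sqrt (N / n.+1%:R) * rnorm x + Num.sqrt (N / n.+1%:R) * rnorm x)))).
  rewrite ler_wpM2l // addrC; apply: le_trans (rnormD _ _) _; rewrite lerD //.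
  exact: le_trans (rnormB_le _ _) (lerD _ _).
(* On the interior the triangle inequality is enough and the factor [c <= 1] is dropped: the
   tolerances can be chosen after the box. *)
rewrite -cN mulrDr [leRHS]mulrDl.
rewrite (_ : c * (_ + _) = 2 * (c * Num.sqrt (N / n.+1%:R)) * rnorm x); last ring.
by rewrite lerD2r ler_piMl // !mulr_ge0 ?addr_ge0 ?rnorm_ge0 // ltW.
Qed.

End spread.

(** * Reordering words in an almost commuting tuple *)

Lemma norm_expi (R : realType) (t : R) : `|expi t| = 1.
Proof. by rewrite normc_def /= cos2Dsin2 sqrtr1. Qed.

Section words.
Context {R : realType} {d : nat} (Theta : 'M[R]_d).

Definition almost_op (delta : R) (K : hilbertType R) (A : 'I_d -> op K K) :=
  forall k l x,
    rnorm (A l (A k x) - expi (Theta k l) *: A k (A l x)) <= delta * rnorm x.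

Definition word (K : hilbertType R) (A : 'I_d -> op K K) (w : seq 'I_d) :
  op K K := foldr (fun k => ocomp (A k)) (oid K) w.

Lemma word_cons (K : hilbertType R) (A : 'I_d -> op K K) k w x :
  word A (k :: w) x = A k (word A w x).
Proof. by []. Qed.

Lemma uni_oid (K : hilbertType R) : uni (oid K).
Proof. by split. Qed.

Lemma uni_word (K : hilbertType R) (A : 'I_d -> op K K) w :
  (forall k, uni (A k)) -> uni (word A w).
Proof.
move=> uA; elim: w => [|k w IHw]; first exact: uni_oid.
exact: uni_comp.
Qed.

(** Each letter of [u] that [k] passes contributes one phase of [Theta] and an error [delta]. The
    phase is fixed before the operators, so it is the same for every tuple. *)
Lemma word_insert k u v : exists2 q : R[i], `|q| = 1 &
  forall (delta : R) (K : hilbertType R) (A : 'I_d -> op K K),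
    (forall k, uni (A k)) -> almost_op delta A -> forall x,
    rnorm (A k (word A (u ++ v) x) - q *: word A (u ++ k :: v) x)
      <= (size u)%:R * delta * rnorm x.
Proof.
elim: u => [|j u [q q1 IHu]].
  exists 1; first by rewrite normr1.
  by move=> delta K A uA hA x; rewrite scale1r subrr rnorm0 !mul0r.
exists (expi (Theta j k) * q); first by rewrite normrM norm_expi q1 mulr1.
move=> delta K A uA hA x; rewrite /= -/(word A _).
have [iA _] := uA j; have [iW _] := uni_word (u ++ v) uA.
rewrite -[X in rnorm X](subrKA (expi (Theta j k) *: A j (A k (word A (u ++ v) x)))).
apply: le_trans (rnormD _ _) _.
rewrite -natr1 !mulrDl mul1r addrC lerD //.
  rewrite -scalerA -scalerBr rnorm_unit ?norm_expi // -opZ -opB.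
  by rewrite (iso_rnorm _ iA) IHu.
by apply: le_trans (hA _ _ _) _; rewrite (iso_rnorm _ iW).
Qed.

(** Insertion sort: the first letter is carried to its place in [w'] past at most as many letters as
    remain in [w], so the number of exchanges is at most quadratic. *)
Lemma word_perm w w' : perm_eq w w' -> exists2 p : R[i], `|p| = 1 &
  forall (delta : R) (K : hilbertType R) (A : 'I_d -> op K K), 0 <= delta ->
    (forall k, uni (A k)) -> almost_op delta A -> forall x,
    rnorm (word A w x - p *: word A w' x)
      <= (size w ^ 2)%:R * delta * rnorm x.
Proof.
elim: w w' => [|k w IHw] w' ww'.
  exists 1; first by rewrite normr1.
  move=> delta K A delta0 _ _ x; move: ww'; rewrite perm_sym => /perm_nilP ->.
  by rewrite scale1r subrr rnorm0 !mulr_ge0 ?rnorm_ge0.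
have kw' : k \in w' by rewrite -(perm_mem ww') mem_head.
case/splitPr: kw' ww' => u v ww'.
have {}ww' : perm_eq w (u ++ v).
  by rewrite -(perm_cons k) (perm_trans ww') // perm_catC /= perm_cons perm_catC.
have [p p1 hp] := IHw _ ww'; have [q q1 hq] := word_insert k u v.
exists (p * q); first by rewrite normrM p1 q1 mulr1.
move=> delta K A delta0 uA hA x; rewrite word_cons.
rewrite -[X in rnorm X](subrKA (p *: A k (word A (u ++ v) x))).
apply: le_trans (rnormD _ _) _.
have [iA _] := uA k.
have h1 : rnorm (A k (word A w x) - p *: A k (word A (u ++ v) x)) <=
    (size w ^ 2)%:R * delta * rnorm x.
  by rewrite -opZ -opB (iso_rnorm _ iA); exact: hp.
have h2 : rnorm (p *: A k (word A (u ++ v) x) - (p * q) *: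
    word A (u ++ k :: v) x) <= (size u)%:R * delta * rnorm x.
  by rewrite -scalerA -scalerBr rnorm_unit //; exact: hq.
apply: le_trans (lerD h1 h2) _; rewrite -!mulrDl -natrD.
rewrite ler_wpM2r ?rnorm_ge0 // ler_wpM2r // ler_nat /=.
have : (size u <= size w)%N by rewrite (perm_size ww') size_cat leq_addr.
by move: (size u) (size w) => a b ab; rewrite -!mulnn mulSn mulnS; lia.
Qed.

Definition box_word n (r : box d n) : seq 'I_d :=
  flatten [seq nseq (r k) k | k <- enum 'I_d].

Lemma count_box_word n (r : box d n) j : count_mem j (box_word r) = r j.
Proof.
rewrite count_flatten -map_comp sumnE big_map big_enum /= (bigD1 j) //=.
rewrite count_nseq /= eqxx mul1n big1 ?addn0 // => k kj.
by rewrite count_nseq /= (negbTE kj).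
Qed.

Lemma size_box_word n (r : box d n) : (size (box_word r) <= d * n)%N.
Proof.
rewrite size_flatten /shape -map_comp sumnE big_map big_enum /=.
apply: (@leq_trans (\sum_(i < d) n)); last by rewrite sum_nat_const card_ord.
by apply: leq_sum => i _; rewrite size_nseq -ltnS.
Qed.

Lemma perm_box_word n k (r : box d n) : r k != ord_max ->
  perm_eq (k :: box_word r) (box_word (box_shift k r)).
Proof.
move=> rk; apply/allP => j _ /=; rewrite -![count _ _]/(count_mem j _).
rewrite !count_box_word ffunE; have [->|jk] := eqVneq j k => //.
rewrite add1n; apply/eqP/esym.
apply: modn_small; rewrite ltn_neqAle ltn_ord andbT eqSS.
by apply: contra rk => /eqP h; apply/eqP/val_inj.
Qed.

(** One choice of [p] and [E] serves all tuples; this is what allows the phases of [A] to cancel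
    those of [B] in [spread]. *)
Lemma word_shift n : exists (p : 'I_d -> box d n -> R[i]) (E : R), 0 <= E /\
  forall (delta : R) (K : hilbertType R) (A : 'I_d -> op K K), 0 <= delta ->
    (forall k, uni (A k)) -> almost_op delta A ->
    forall k (r : box d n) x, r k != ord_max ->
    rnorm (A k (word A (box_word r) x) -
      p k r *: word A (box_word (box_shift k r)) x) <= E * delta * rnorm x.
Proof.
have ex (kr : 'I_d * box d n) : exists p : R[i], kr.2 kr.1 != ord_max ->
    forall (delta : R) (K : hilbertType R) (A : 'I_d -> op K K), 0 <= delta ->
    (forall k, uni (A k)) -> almost_op delta A ->
    forall x, rnorm (A kr.1 (word A (box_word kr.2) x) -
      p *: word A (box_word (box_shift kr.1 kr.2)) x)
        <= ((d * n).+1 ^ 2)%:R * delta * rnorm x.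
  (* On the face nothing is claimed, and 0 is a default value. *)
  case: kr => k r /=; have [rk|rk] := boolP (r k == ord_max); first by exists 0.
  have [p p1 hp] := word_perm (perm_box_word rk).
  exists p => _ delta K A delta0 uA hA x.
  apply: le_trans (hp _ _ _ delta0 uA hA x) _.
  rewrite ler_wpM2r ?rnorm_ge0 // ler_wpM2r // ler_nat leq_sqr ltnS.
  exact: size_box_word.
have [p hp] := choice ex.
exists (fun k r => p (k, r)), ((d * n).+1 ^ 2)%:R; split=> //.
move=> delta K A delta0 uA hA k r x rk.
exact: (hp (k, r) rk delta K A delta0 uA hA x).
Qed.

End words.

(** * Ergodicity: unitaries that rescale the tuple *)

Section implementable.
Context {R : realType} {d : nat} (Theta : 'M[R]_d).

(** Conjugation by [W] multiplies each [A k] by [z k 0] up to [C * delta]. Fixing [C] before the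
    operators keeps the later choice of [delta] uniform. *)
Definition implementable : set 'cV[R[i]]_d := [set z | torus z /\
  exists2 C : R, 0 <= C &
  forall (delta : R) (K : hilbertType R) (A : 'I_d -> op K K),
    0 <= delta -> (forall k, uni (A k)) -> almost_op Theta delta A ->
    exists2 W : op K K, uni W & forall k x,
      rnorm (W (A k x) - z k 0 *: A k (W x)) <= C * delta * rnorm x].

Lemma norm_inv1 (c : R[i]) : `|c| = 1 -> `|c^-1| = 1.
Proof. by move=> c1; rewrite normfV c1 invr1. Qed.

Lemma implementable_subgroup : torus_subgroup implementable.
Proof.
split.
- by move=> z [].
- split; first by move=> k; rewrite mxE normr1.
  exists 0 => // delta K A _ _ _; exists (oid K); first exact: uni_oid.
  by move=> k x; rewrite mxE scale1r subrr rnorm0 !mul0r.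
- move=> z w [tz [C C0 hz]] [tw [D D0 hw]]; split.
    by move=> k; rewrite mxE normrM tz tw mulr1.
  exists (C + D); first exact: addr_ge0.
  move=> delta K A delta0 uA hA.
  have [W uW hW] := hz _ _ _ delta0 uA hA.
  have [X uX hX] := hw _ _ _ delta0 uA hA.
  have [iW _] := uW; have [iX _] := uX.
  exists (ocomp W X) => [|k x]; first exact: uni_comp.
  rewrite mxE -[X in rnorm X]/(W (X (A k x)) - (z k 0 * w k 0) *: A k (W (X x))).
  rewrite -[X in rnorm X](subrKA (w k 0 *: W (A k (X x)))).
  apply: le_trans (rnormD _ _) _; rewrite addrC !mulrDl lerD //.
    rewrite mulrC -scalerA -scalerBr rnorm_unit //.
    by apply: le_trans (hW _ _) _; rewrite iso_rnorm.
  by rewrite -opZ -opB (iso_rnorm _ iW).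
- move=> z [tz [C C0 hz]]; split.
    by move=> k; rewrite mxE norm_inv1.
  exists C => // delta K A delta0 uA hA.
  have [W uW hW] := hz _ _ _ delta0 uA hA; have [iW iW'] := uW.
  exists (dag W) => [|k x]; first exact: uni_dag.
  have zk0 : z k 0 != 0 by rewrite -normr_eq0 tz oner_eq0.
  rewrite mxE -(iso_rnorm _ iW) opB opZ -(rnorm_unit _ (tz k)).
  rewrite scalerBr scalerA mulfV // scale1r [W (dag W _)]iW' -rnormN opprB.
  rewrite -{2}(iW' x) dagK.
  by apply: le_trans (hW _ _) _; rewrite (iso_rnorm _ iW').
Qed.

Lemma implementable_col l : implementable (col l (phase_mx Theta)).
Proof.
split; first by move=> k; rewrite !mxE norm_expi.
exists 1 => // delta K A delta0 uA hA; exists (A l) => // k x.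
by rewrite !mxE mul1r; exact: hA.
Qed.

(** The implementable points form a subgroup containing column [l] of the phase matrix, implemented
    by [A l] itself. Hence they include the generated subgroup, which meets the [eta]-ball around
    [z]. *)
Lemma ergodic_implement z (eta : R) : ergodic Theta -> torus z -> 0 < eta ->
  exists2 C : R, 0 <= C &
  forall (delta : R) (K : hilbertType R) (A : 'I_d -> op K K),
    0 <= delta -> (forall k, uni (A k)) -> almost_op Theta delta A ->
    exists2 W : op K K, uni W & forall k x,
      rnorm (W (A k x) - z k 0 *: A k (W x)) <= (C * delta + eta) * rnorm x.
Proof.
move=> erg tz eta0.
have eta0' : (0 : R[i]) < eta%:C by rewrite ltcR.
have [w [Gw zw]] := erg z tz _ (nbhsx_ballx z _ eta0').
have [tw [C C0 hw]] : implementable w.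
  apply: (smallest_sub implementable_subgroup _ Gw).
  by move=> _ [l _ <-]; exact: implementable_col.
exists C => // delta K A delta0 uA hA.
have [W uW hW] := hw _ _ _ delta0 uA hA.
exists W => // k x; rewrite -[X in rnorm X](subrKA (w k 0 *: A k (W x))).
apply: le_trans (rnormD _ _) _; rewrite mulrDl lerD // -scalerBl rnormZ.
have [iW _] := uW; have [iA _] := uA k.
rewrite (iso_rnorm _ iA) (iso_rnorm _ iW) ler_wpM2r ?rnorm_ge0 //.
have : ball (z k 0) eta%:C (w k 0) by case: zw => _; exact.
rewrite -ball_normE /= distrC => h.
by apply/ltW; rewrite -ltcR; exact: h.
Qed.

End implementable.

(** * Weighted shifts on [ell2] *)

Lemma sum_inj_le (R : realType) (F : nat -> R) (P : pred nat) (f : nat -> nat) n :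
  (forall k, 0 <= F k) -> {in P &, injective f} ->
  exists m, \sum_(0 <= k < n | P k) F (f k) <= \sum_(0 <= k < m) F k.
Proof.
move=> F0 fI; pose s := [seq f k | k <- index_iota 0 n & P k].
have s_uniq : uniq s.
  rewrite map_inj_in_uniq ?filter_uniq ?iota_uniq // => x y.
  by rewrite !mem_filter => /andP[Px _] /andP[Py _]; exact: fI.
exists (\max_(k <- s) k).+1.
rewrite [leLHS](_ : _ = \sum_(k <- s) F k); last by rewrite /s big_map big_filter.
have sub : {subset s <= index_iota 0 (\max_(k <- s) k).+1}.
  by move=> k ks; rewrite mem_index_iota ltnS /=; exact: (@leq_bigmax_seq _ s xpredT id k ks isT).
set t := index_iota _ _ in sub *.
have st : perm_eq s [seq k <- t | k \in s].
  apply: uniq_perm; rewrite ?filter_uniq ?iota_uniq // => k.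
  by rewrite mem_filter; case: (boolP (k \in s)) => // /sub ->.
rewrite (perm_big _ st) big_filter [leRHS](bigID (mem s)) /= lerDl.
by apply: sumr_ge0.
Qed.

Section contractions.
Context {R : realType}.

Lemma Re_Ni (z : R[i]) : complex.Re (- 'i%C * z) = complex.Im z.
Proof. by case: z => a b /=; rewrite oppr0 mul0r sub0r mulN1r opprK. Qed.

(* Letting [t] tend to plus or minus infinity in                               *)
(* [|g (y + t f x)| <= |y + t f x|] forces the terms linear in [t] to agree.   *)
Lemma contraction_adjoint (H K : hilbertType R) (f : {linear H -> K})
    (g : {linear K -> H}) :
  (forall x, rnorm (f x) <= rnorm x) -> (forall y, rnorm (g y) <= rnorm y) ->
  cancel f g -> forall x y, inner (f x) y = inner x (g y).
Proof.
move=> cf cg fK.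
have re x y : complex.Re (inner (f x) y) = complex.Re (inner x (g y)).
  have ineq (t : R) : rnorm (g y) ^+ 2 + 2 * t * complex.Re (inner x (g y))
      <= rnorm y ^+ 2 + 2 * t * complex.Re (inner (f x) y).
    have : rnorm (g (t%:C *: f x + y)) ^+ 2 <= rnorm (t%:C *: f x + y) ^+ 2.
      by rewrite ler_sqr ?nnegrE ?rnorm_ge0.
    rewrite linearP fK !rnorm_sqrD !innerZl.
    have ReZ (z : R[i]) : complex.Re (t%:C * z) = t * complex.Re z.
      by case: z => a b /=; rewrite mul0r subr0.
    rewrite !ReZ !rnormZ => h.
    have : (complex.Re `|t%:C| * rnorm (f x)) ^+ 2 <=
        (complex.Re `|t%:C| * rnorm x) ^+ 2.
      have t0 : 0 <= complex.Re `|t%:C| by rewrite -ler0c RRe_real // ger0_real.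
      by rewrite ler_sqr ?nnegrE ?mulr_ge0 ?rnorm_ge0 // ler_wpM2l.
    lra.
  apply/eqP; rewrite -subr_eq0; apply/negPn/negP => D0.
  set D := _ - _ in D0; pose c := rnorm y ^+ 2 - rnorm (g y) ^+ 2 + 1.
  (* At this [t] the linear term equals [- c], which is one unit too low for the inequality. *)
  have := ineq (- (c / (2 * D))).
  suff : 2 * - (c / (2 * D)) * D = - c by rewrite /c /D; lra.
  by field.
move=> x y; apply: complex_ext => //.
by rewrite -!Re_Ni -!innerZl -linearZ re.
Qed.

End contractions.

Section ell2_ops.
Context {R : realType} {H : hilbertType R}.

Lemma ell2_ext (x y : ell2 H) : (forall k, x k = y k) -> x = y.
Proof. by move=> h; apply/val_inj/funext. Qed.

Lemma pullback_exists (P : pred nat) (f : nat -> nat) (u : nat -> R[i]) :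
  {in P &, injective f} -> (forall k, `|u k| = 1) ->
  exists T : {linear ell2 H -> ell2 H}, (forall x, rnorm (T x) <= rnorm x) /\
    forall x k, T x k = if P k then u k *: x (f k) else 0.
Proof.
move=> fI u1.
have ex (x : ell2 H) : exists y : ell2 H, rnorm y <= rnorm x /\
    forall k, y k = if P k then u k *: x (f k) else 0.
  have [|y yE yx] := @rnorm_ell2_le _ _ (rnorm x)
    (fun k => if P k then u k *: x (f k) else 0) (rnorm_ge0 _).
    move=> n; have [m hm] := @sum_inj_le _ (fun k => rnorm (x k) ^+ 2) P f n
      (fun _ => sqr_ge0 _) fI.
    rewrite ell2_rnorm_sq; apply: le_trans (ell2_partial_le x m).
    apply: le_trans hm; rewrite [leRHS]big_mkcond /=; apply: ler_sum => k _.
    by case: ifP => _; rewrite ?rnorm_unit // rnorm0 expr0n.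
  by exists y; split=> // k; rewrite yE.
have [T hT] := choice ex.
have lT : linear T.
  move=> a x y; apply: ell2_ext => k; rewrite ell2D ell2Z !(hT _).2.
  case: ifP => _; last by rewrite scaler0 addr0.
  by rewrite ell2D ell2Z scalerDr !scalerA mulrC.
pose L := GRing.isLinear.Build R[i] (ell2 H) (ell2 H) *:%R T lT.
pose T' : {linear ell2 H -> ell2 H} := HB.pack T L.
by exists T'; split=> x; [exact: (hT x).1 | exact: (hT x).2].
Qed.

(** Sequences are given by coordinates, so [S] is a pullback along a left inverse of [f], cut to the
    range of [f], and its adjoint is the pullback along [f] with conjugate weights. Both are
    contractions, and [contraction_adjoint] applies. *)
Lemma weighted_shift (f : nat -> nat) (u : nat -> R[i]) :
  injective f -> (forall k, `|u k| = 1) ->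
  exists S : op (ell2 H) (ell2 H), [/\ iso S,
    forall x k, S x (f k) = u k *: x k,
    forall x j, (forall k, j <> f k) -> S x j = 0 &
    forall x k, dag S x k = conjc (u k) *: x (f k)].
Proof.
move=> fI u1.
have ex j : exists k, (exists i, f i = j) -> f k = j.
  by have [[i fi]|nj] := pselect (exists i, f i = j); [exists i|exists 0%N].
have [h hh] := choice ex.
have hK k : h (f k) = k by apply: fI; apply: hh; exists k.
pose P : pred nat := [pred j | f (h j) == j].
have [|S [cS SE]] := @pullback_exists P h (u \o h) _ (fun k => u1 (h k)).
  by move=> i j; rewrite !inE => /eqP {2}<- /eqP {2}<- ->.
have [||D [cD DE]] := @pullback_exists predT f (conjc \o u).
- by move=> i j _ _; exact: fI.
- by move=> k; rewrite /= norm_conjc.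
have SK : cancel S D.
  move=> x; apply: ell2_ext => k; rewrite DE /= SE /P /= hK eqxx scalerA.
  by rewrite conjcMl // scale1r.
exists (Op (contraction_adjoint cS cD SK)); split => //.
- by move=> x k; rewrite /= SE /P /= !hK eqxx.
- move=> x j hj; rewrite /= SE /P /=; case: eqP => // hj'.
  by have := hj (h j); rewrite hj'.
Qed.


Lemma splits_exists (f g : nat -> nat) :
  injective f -> injective g -> (forall i j, f i <> g j) ->
  (forall k, (exists j, f j = k) \/ (exists j, g j = k)) ->
  exists S T : op (ell2 H) (ell2 H), [/\ splits S T,
    forall x k, S x (f k) = x k, forall x k, S x (g k) = 0,
    forall x k, T x (g k) = x k & forall x k, T x (f k) = 0].
Proof.
move=> fI gI fg fUg.
have u1 (k : nat) : `|1 : R[i]| = 1 by rewrite normr1.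
have [S [iS SE S0 dSE]] := weighted_shift fI u1.
have [T [iT TE T0 dTE]] := weighted_shift gI u1.
have {}S0 x k : S x (g k) = 0 by apply: S0 => i /esym; exact: fg.
have {}T0 x k : T x (f k) = 0 by apply: T0 => i; exact: fg.
exists S, T; split=> //; first split=> //.
- by move=> x; apply: ell2_ext => k; rewrite dSE T0 scaler0.
- move=> x; apply: ell2_ext => k; rewrite ell2D.
  have [[j <-]|[j <-]] := fUg k.
    by rewrite T0 addr0 SE dSE conjc1 !scale1r.
  by rewrite S0 add0r TE dTE conjc1 !scale1r.
- by move=> x k; rewrite SE scale1r.
- by move=> x k; rewrite TE scale1r.
Qed.

End ell2_ops.

(** * The amplified tuple and its doubling *)

Section amplification.
Context {R : realType} {H : hilbertType R}.

Lemma ampl_adjoint (U W : bounded_op H) : is_adjoint U W ->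
  forall x y, inner (ampl U x) y = inner x (ampl W y).
Proof.
move=> UW x y; rewrite -[LHS]/(ell2_inner _ _) -[RHS]/(ell2_inner _ _).
by congr (limn (series _) +i* limn (series _)); apply/funext => k; rewrite UW.
Qed.

Lemma opnorm_leP (f : {linear H -> H}) (e : R) :
  (opnorm f <= e%:E)%E -> forall x, rnorm (f x) <= e * rnorm x.
Proof.
move=> fe x; have [x0|x0] := eqVneq (rnorm x) 0.
  by rewrite (rnorm_eq0 x0) linear0 rnorm0 mulr0.
have {}x0 : 0 < rnorm x by rewrite lt_neqAle eq_sym x0 rnorm_ge0.
have xV0 : 0 <= (rnorm x)^-1 by rewrite invr_ge0 ltW.
have : ((rnorm (f ((rnorm x)^-1%:C *: x)))%:E <= e%:E)%E.
  apply: le_trans fe; apply: ereal_sup_ubound; exists ((rnorm x)^-1%:C *: x) => //=.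
  by rewrite rnormE rnorm_scaleR // mulVf ?gt_eqF.
by rewrite lee_fin linearZ /= rnorm_scaleR // ler_pdivrMl // mulrC.
Qed.

Lemma ell2_rnorm_le (x y : ell2 H) (e : R) : 0 <= e ->
  (forall k, rnorm (x k) <= e * rnorm (y k)) -> rnorm x <= e * rnorm y.
Proof.
move=> e0 xy.
have [||z zE ze] := @rnorm_ell2_le _ _ (e * rnorm y) x.
- exact: mulr_ge0 (rnorm_ge0 _).
- move=> n; rewrite exprMn ell2_rnorm_sq.
  apply: le_trans (ler_wpM2l (sqr_ge0 _) (ell2_partial_le y n)).
  rewrite mulr_sumr; apply: ler_sum => k _.
  by rewrite -exprMn ler_sqr ?nnegrE ?mulr_ge0 ?rnorm_ge0.
by rewrite (_ : x = z) //; apply: ell2_ext => k; rewrite zE.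
Qed.

Lemma ampl_ops d (Theta : 'M[R]_d) (delta : R) (U : 'I_d -> bounded_op H) :
  0 <= delta -> unitary_tuple U -> almost_theta_commuting delta Theta U ->
  exists A : 'I_d -> op (ell2 H) (ell2 H), [/\ forall k, uni (A k),
    forall k x, A k x = ampl (U k) x & almost_op Theta delta A].
Proof.
move=> delta0 uU hU; have [W hW] := choice uU.
pose A k : op (ell2 H) (ell2 H) :=
  Op (ampl_adjoint (let: And3 h _ _ := hW k in h)).
exists A; split=> //.
  move=> k; have [_ UK WK] := hW k.
  by split=> x; apply: ell2_ext => j; [exact: UK | exact: WK].
move=> k l x; apply: ell2_rnorm_le => // j.
have lin : linear (fun h => U l (U k h) - expi (Theta k l) *: U k (U l h)).
  by move=> a u v; rewrite !linearP /= addrACA -scalerDr.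
pose L := GRing.isLinear.Build R[i] H H *:%R _ lin.
pose T : {linear H -> H} := HB.pack (fun h => _) L.
exact: (@opnorm_leP T delta (hU k l)).
Qed.

End amplification.

Section interleave.

Lemma double_neq i j : i.*2 <> j.*2.+1.
Proof. by move/(congr1 odd); rewrite oddS !odd_double. Qed.

Lemma double_cover k : (exists j, j.*2 = k) \/ (exists j, j.*2.+1 = k).
Proof.
rewrite -(odd_double_half k); case: (odd k).
  by right; exists k./2.
by left; exists k./2.
Qed.

(** An amplification acts coordinatewise, so it commutes with spreading a sequence over the even or
    the odd places. This is where the factor [ell2] enters the swindle. *)
Lemma ampl_splits (R : realType) (H : hilbertType R) :
  exists S T : op (ell2 H) (ell2 H), [/\ splits S T,
    forall (U : bounded_op H) x, S (ampl U x) = ampl U (S x) &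
    forall (U : bounded_op H) x, T (ampl U x) = ampl U (T x)].
Proof.
have [|||S [T [sST S0 S1 T1 T0]]] :=
  @splits_exists R H double (fun j => j.*2.+1) double_inj.
- by move=> j k /succn_inj/double_inj.
- exact: double_neq.
- exact: double_cover.
exists S, T; split=> // U x; apply: ell2_ext => k.
  rewrite -[RHS]/(U (S x k)); have [[j <-]|[j <-]] := double_cover k.
    by rewrite !S0.
  by rewrite !S1 linear0.
rewrite -[RHS]/(U (T x k)); have [[j <-]|[j <-]] := double_cover k.
  by rewrite !T0 linear0.
by rewrite !T1.
Qed.

End interleave.

(** * The exactly commuting model *)

Section twisted_shift.
Context {R : realType} {d : nat} (Theta : 'M[R]_d) (H : hilbertType R).

Local Notation lattice := {ffun 'I_d -> int}.

Lemma lattice_coding : exists (enc : nat * lattice -> nat) dec,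
  cancel enc dec /\ cancel dec enc.
Proof.
have : ([set: nat * lattice] #= [set: nat])%card.
  apply: eq_card_nat; first exact: countableP.
  move=> /(finite_image (@fst nat lattice)) fin; apply: infinite_nat.
  by apply: sub_finite_set fin => i _; exists (i, 0).
move=> /card_set_bijP[f]; rewrite setTT_bijective => -[g fK gK].
by exists f, g; split.
Qed.

Definition unit_vec (k : 'I_d) : lattice := [ffun j => (k == j)%:Z].

(** The symmetric gauge: half of the phase sits on each order of two steps, and antisymmetry of
    [Theta] makes the quotient the full phase ([twistD]). *)
Definition twist (n : lattice) (k : 'I_d) : R[i] :=
  expi (\sum_j (n j)%:~R * Theta j k / 2).

Definition weight (w : seq 'I_d) : lattice := [ffun j => (count_mem j w)%:Z].

Lemma weight_cons k w : weight (k :: w) = unit_vec k + weight w.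
Proof. by apply/ffunP => j; rewrite !ffunE /= PoszD. Qed.

Lemma expiD (a b : R) : expi (a + b) = expi a * expi b.
Proof.
by apply: complex_ext; rewrite ?ReM ?ImM /= ?cosD ?sinD //; rewrite addrC.
Qed.

Lemma twistD n k l : antisymmetric_mx Theta ->
  twist (n + unit_vec k) l * twist n k =
  expi (Theta k l) * (twist (n + unit_vec l) k * twist n l).
Proof.
move=> aT; rewrite /twist.
have shift m j : \sum_i ((n + unit_vec m) i)%:~R * Theta i j / 2 =
   \sum_i (n i)%:~R * Theta i j / 2 + Theta m j / 2.
  under eq_bigr => i _ do rewrite !ffunE rmorphD /= mulrDl mulrDl.
  rewrite big_split /=; congr (_ + _); rewrite (bigD1 m) //= eqxx mul1r.
  by rewrite big1 ?addr0 // => i im; rewrite eq_sym (negbTE im) !mul0r.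
rewrite !shift -!expiD; congr (expi _).
have -> : Theta l k = - Theta k l by have /matrixP/(_ k l) := aT; rewrite !mxE.
lra.
Qed.

(** Coding [nat * lattice] by [nat] puts the twisted translations of the lattice, with infinite
    multiplicity, on the very space [ell2 H]. [t0] and [t1] split the multiplicity index by parity;
    [tau] embeds the whole space as the fibre over the origin, which words of distinct weights move
    to orthogonal fibres. *)
Lemma twisted_shift : antisymmetric_mx Theta ->
  exists (B : 'I_d -> op (ell2 H) (ell2 H)) (t0 t1 tau : op (ell2 H) (ell2 H)),
  [/\ forall k, uni (B k), almost_op Theta 0 B,
      [/\ splits t0 t1, forall k x, t0 (B k x) = B k (t0 x) &
        forall k x, t1 (B k x) = B k (t1 x)],
      iso tau &
      forall v w x, weight v != weight w ->
        dag tau (dag (word B v) (word B w (tau x))) = 0].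
Proof.
move=> aT; have [enc [dec [encK decK]]] := lattice_coding.
have encI := can_inj encK.
have coord (x y : ell2 H) : (forall i n, x (enc (i, n)) = y (enc (i, n))) -> x = y.
  by move=> h; apply: ell2_ext => k; rewrite -(decK k); case: (dec k).
pose sh k j := enc ((dec j).1, (dec j).2 + unit_vec k).
have shE k i n : sh k (enc (i, n)) = enc (i, n + unit_vec k) by rewrite /sh encK.
have shI k : injective (sh k).
  move=> i j /encI [h1 /addIr h2].
  by apply: (can_inj decK); rewrite [dec i]surjective_pairing h1 h2 -surjective_pairing.
have tw1 k j : `|twist (dec j).2 k| = 1 by exact: norm_expi.
have [B hB] := choice (fun k => weighted_shift (H := H) (shI k) (tw1 k)).
have BE k x i n : B k x (enc (i, n + unit_vec k)) = twist n k *: x (enc (i, n)).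
  by have [_ BE _ _] := hB k; rewrite -shE BE encK.
have dBE k x i n : dag (B k) x (enc (i, n)) =
    conjc (twist n k) *: x (enc (i, n + unit_vec k)).
  by have [_ _ _ dBE] := hB k; rewrite dBE encK shE.
have [|||| t0 [t1 [t01 t00 t0z t11 t1z]]] := @splits_exists R H
  (fun j => enc ((dec j).1.*2, (dec j).2)) (fun j => enc ((dec j).1.*2.+1, (dec j).2)).
- move=> i j /encI[/double_inj h1 h2]; apply: (can_inj decK).
  by rewrite [dec i]surjective_pairing h1 h2 -surjective_pairing.
- move=> i j /encI[/double_inj h1 h2]; apply: (can_inj decK).
  by rewrite [dec i]surjective_pairing h1 h2 -surjective_pairing.
- by move=> i j /encI [/double_neq].
- move=> k; rewrite -(decK k); case: (dec k) => i n.
  by have [[j <-]|[j <-]] := double_cover i; [left|right];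
    exists (enc (j, n)); rewrite encK.
have {}t00 x i n : t0 x (enc (i.*2, n)) = x (enc (i, n)).
  by have := t00 x (enc (i, n)); rewrite encK.
have {}t0z x i n : t0 x (enc (i.*2.+1, n)) = 0.
  by have := t0z x (enc (i, n)); rewrite encK.
have {}t11 x i n : t1 x (enc (i.*2.+1, n)) = x (enc (i, n)).
  by have := t11 x (enc (i, n)); rewrite encK.
have {}t1z x i n : t1 x (enc (i.*2, n)) = 0.
  by have := t1z x (enc (i, n)); rewrite encK.
have [||tau [itau tauE tau0 dtauE]] := @weighted_shift R H
  (fun j => enc (j, 0)) (fun=> 1).
- by move=> i j /encI [].
- by move=> k; rewrite normr1.
exists B, t0, t1, tau; split=> //.
- move=> k; split; first by have [] := hB k.
  move=> x; apply: coord => i n; rewrite dagK -(subrK (unit_vec k) n) BE dBE.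
  by rewrite scalerA conjcMr ?norm_expi // scale1r.
- move=> k l x; rewrite mul0r (_ : _ - _ = 0) ?rnorm0 //.
  apply/eqP; rewrite subr_eq0; apply/eqP/coord => i n.
  rewrite ell2Z -(subrK (unit_vec k + unit_vec l) n).
  move: (n - _) => m.
  have -> : B l (B k x) (enc (i, m + (unit_vec k + unit_vec l))) =
      (twist (m + unit_vec k) l * twist m k) *: x (enc (i, m)).
    by rewrite addrA !BE scalerA.
  have -> : B k (B l x) (enc (i, m + (unit_vec k + unit_vec l))) =
      (twist (m + unit_vec l) k * twist m l) *: x (enc (i, m)).
    by rewrite [unit_vec k + _]addrC addrA !BE scalerA.
  by rewrite scalerA twistD.
- split=> // k x; apply: coord => i n; rewrite -(subrK (unit_vec k) n) BE;
    have [[j <-]|[j <-]] := double_cover i.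
  + by rewrite !t00 BE.
  + by rewrite !t0z scaler0.
  + by rewrite !t1z scaler0.
  + by rewrite !t11 BE.
- have BwE u : exists c : lattice -> R[i], forall x i n,
      word B u x (enc (i, n + weight u)) = c n *: x (enc (i, n)).
    elim: u => [|k u [c hc]].
      exists (fun=> 1) => x i n; rewrite scale1r -[LHS]/(x _).
      by rewrite (_ : weight [::] = 0) ?addr0 //; apply/ffunP => j; rewrite !ffunE.
    exists (fun n => twist (n + weight u) k * c n) => x i n.
    by rewrite weight_cons [unit_vec k + _]addrC addrA word_cons BE hc scalerA.
  have dBwE u : exists c : lattice -> R[i], forall x i n,
      dag (word B u) x (enc (i, n)) = c n *: x (enc (i, n + weight u)).
    elim: u => [|k u [c hc]].
      exists (fun=> 1) => x i n; rewrite scale1r -[LHS]/(x _).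
      by rewrite (_ : weight [::] = 0) ?addr0 //; apply/ffunP => j; rewrite !ffunE.
    exists (fun n => c n * conjc (twist (n + weight u) k)) => x i n.
    rewrite weight_cons [unit_vec k + _]addrC addrA.
    by rewrite -[LHS]/(dag (word B u) (dag (B k) x) _) hc dBE scalerA.
  (* The coordinate over 0 comes from the fibre of [tau x] over [weight v - weight w], which is not
     the origin and therefore carries 0. *)
  move=> v w x vw; apply: ell2_ext => j; rewrite dtauE.
  have [c hc] := BwE w; have [c' hc'] := dBwE v.
  rewrite hc' -(subrK (weight w) (0 + weight v)) hc tau0 ?scaler0 //.
  move=> k /encI[_] /eqP; rewrite add0r subr_eq0.
  exact/negP.
Qed.

End twisted_shift.

(** * Characters of a finite torus *)

Section fourier.
Context {R : realType} {d n : nat}.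
Implicit Types (zeta : R[i]) (a r : box d n).

Lemma complex_prim_root N : (0 < N)%N -> exists zeta : R[i], N.-primitive_root zeta.
Proof.
move=> N0; have [rs] := closed_field_poly_normal ('X^N - 1 : {poly R[i]}).
rewrite (monicP (monicXnsubC _ N0)) scale1r => rsE.
have rsU : uniq rs.
  by rewrite -separable_prod_XsubC -rsE separable_Xn_sub_1 // pnatr_eq0 -lt0n.
have rs1 : all N.-unity_root rs.
  by apply/allP => z; rewrite -root_prod_XsubC -rsE.
have rsN : (N <= size rs)%N.
  by rewrite -ltnS -(size_prod_XsubC rs id) -rsE size_XnsubC.
by have /hasP[z _ hz] := has_prim_root N0 rs1 rsU rsN; exists z.
Qed.

Lemma norm_prim_root N zeta : N.-primitive_root zeta -> `|zeta| = 1.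
Proof.
move=> hz; have N0 := prim_order_gt0 hz.
apply/eqP; rewrite -(@eqrXn2 _ N) // -normrX (prim_expr_order hz) normr1.
by rewrite expr1n.
Qed.

Definition box_char zeta a r : R[i] := \prod_k zeta ^+ (a k * r k).

Lemma norm_box_char zeta a r : `|zeta| = 1 -> `|box_char zeta a r| = 1.
Proof.
by move=> z1; rewrite normr_prod big1 // => k _; rewrite normrX z1 expr1n.
Qed.

Lemma box_char_shift zeta a r k : r k != ord_max ->
  box_char zeta a (box_shift k r) = zeta ^+ a k * box_char zeta a r.
Proof.
move=> rk; rewrite /box_char (bigD1 k) //= [in RHS](bigD1 k) //= mulrA.
congr (_ * _).
  rewrite ffunE eqxx -exprD -mulnS; congr (_ ^+ (_ * _)).
  apply: modn_small; rewrite ltn_neqAle ltn_ord andbT eqSS.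
  by apply: contra rk => /eqP h; apply/eqP/val_inj.
by apply: eq_bigr => j jk; rewrite ffunE (negbTE jk).
Qed.

(** The sum factors over the coordinates. Where [r] and [r'] differ, the factor is a full geometric
    sum of an [n.+1]-st root of unity other than 1, hence zero. *)
Lemma box_char_orth zeta r r' : n.+1.-primitive_root zeta ->
  \sum_a conjc (box_char zeta a r) * box_char zeta a r' =
  (r == r')%:R * #|{: box d n}|%:R.
Proof.
move=> hz; have z1 := norm_prim_root hz.
have [<-|rr'] := eqVneq r r'.
  rewrite (eq_bigr (fun=> 1)) => [|a _]; first by rewrite sumr_const mul1r.
  by rewrite conjcMl // norm_box_char.
have [k rk] : exists k, r k != r' k.
  apply/existsP; move: rr'; apply: contraNT; rewrite negb_exists => /forallP h.
  by apply/eqP/ffunP => k; apply/eqP; have := h k; rewrite negbK.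
pose w j : R[i] := conjc (zeta ^+ r j) * zeta ^+ r' j.
rewrite mul0r (eq_bigr (fun a => \prod_j w j ^+ (a j))) => [|a _]; last first.
  rewrite rmorph_prod /= -big_split /=; apply: eq_bigr => j _.
  by rewrite /w exprMn -rmorphXn /= -!exprM [(a j * r j)%N]mulnC [(a j * r' j)%N]mulnC.
rewrite -(bigA_distr_bigA (fun j (i : 'I_n.+1) => w j ^+ i)) /= (bigD1 k) //=.
rewrite (_ : \sum_(i < n.+1) w k ^+ i = 0) ?mul0r //.
have wk1 : w k - 1 != 0.
  rewrite subr_eq0; apply: contra rk => /eqP wk.
  have : zeta ^+ r k == zeta ^+ r' k.
    rewrite -[X in X == _]mulr1 -wk /w mulrA conjcMr ?mul1r //.
    by rewrite normrX z1 expr1n.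
  by rewrite (eq_prim_root_expr hz) !modn_small.
apply: (mulfI wk1); rewrite mulr0 -subrX1 /w exprMn -rmorphXn /=.
by rewrite -!exprM ![(_ * n.+1)%N]mulnC !exprM (prim_expr_order hz) !expr1n conjc1 mulr1 subrr.
Qed.

End fourier.

(** * The two embeddings *)

Section isometry_family.
Context {R : realType} {K : hilbertType R} (u0 u1 : op K K).

(** The isometries [u1^j u0] have pairwise orthogonal ranges and commute with whatever [u0] and [u1]
    commute with. *)
Definition cuntz (j : nat) : op K K := iter j (ocomp u1) u0.

Lemma cuntzS j x : cuntz j.+1 x = u1 (cuntz j x).
Proof. by []. Qed.

Lemma dag_cuntzS j x : dag (cuntz j.+1) x = dag (cuntz j) (dag u1 x).
Proof. by []. Qed.

Lemma iso_cuntz j : splits u0 u1 -> iso (cuntz j).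
Proof. by case=> i0 i1 _ _; elim: j => // j IHj; exact: iso_comp. Qed.

Lemma cuntz_orth i j x : splits u0 u1 -> i != j ->
  dag (cuntz i) (cuntz j x) = 0.
Proof.
move=> hu; have u10 := splits_orth _ hu; case: hu => [_ i1 u01 _].
elim: i j => [|i IHi] [|j] // ij.
- exact: u01.
- by rewrite dag_cuntzS u10 op0.
- by rewrite dag_cuntzS cuntzS i1 IHi.
Qed.

Lemma cuntz_comm (A : op K K) j x : (forall x, u0 (A x) = A (u0 x)) ->
  (forall x, u1 (A x) = A (u1 x)) -> cuntz j (A x) = A (cuntz j x).
Proof.
by move=> h0 h1; elim: j x => [//|j IHj] x; rewrite !cuntzS IHj h1.
Qed.

End isometry_family.

Section embeddings.
Context {R : realType} {d : nat} (Theta : 'M[R]_d).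

(** [spread] with [Xi r] the monomial [r] of [B] applied to the fibre [tau]: there the relations are
    exact, and only the words in [A] cost [E * delta]. *)
Lemma embed_exact n : exists2 E : R, 0 <= E &
  forall (delta : R) (K : hilbertType R) (A B : 'I_d -> op K K) (tau : op K K),
    0 <= delta -> (forall k, uni (A k)) -> almost_op Theta delta A ->
    (forall k, uni (B k)) -> almost_op Theta 0 B -> iso tau ->
    (forall v w x, weight v != weight w ->
        dag tau (dag (word B v) (word B w (tau x))) = 0) ->
  exists2 J : op K K, iso J & intertw
    (#|{: box d n}|%:R * (E * delta) + 2 / Num.sqrt n.+1%:R) J A B.
Proof.
have [p [E [E0 hE]]] := word_shift Theta n.
exists E => // delta K A B tau delta0 uA hA uB hB itau otau.
have [||||||||| J iJ hJ] := @spread _ _ n _ _ A B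
  (fun r => ocomp (word B (box_word r)) tau) (fun r => word A (box_word r)) p 0 (E * delta).
- by [].
- exact: mulr_ge0.
- exact: uA.
- exact: uB.
- by move=> r; apply: iso_comp => //; have [] := uni_word (box_word r) uB.
- move=> r r' x rr'.
  rewrite -[LHS]/(dag tau (dag (word B _) (word B _ (tau x)))) otau //.
  apply: contra rr' => /eqP/ffunP h; apply/eqP/ffunP => j; apply/val_inj.
  by have := h j; rewrite !ffunE !count_box_word => -[].
- by move=> r; exact: uni_word.
- move=> k r x rk; have := hE 0 K B (lexx _) uB hB k r (tau x) rk.
  by rewrite mulr0 !mul0r.
- by move=> k r x rk; exact: hE.
by exists J => //; move: hJ; rewrite add0r.
Qed.

(** [spread] with [Xi r] equal to [Y r] after the monomial [r] of [A], where [Y r] is the normalized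
    sum over characters of [S a (W a)] with weight the character value at [r]. Moving [A k] past
    [W a] multiplies the term by [zeta ^+ a k], which is exactly the effect of shifting [r]. *)
Lemma embed_almost n (eta : R) : ergodic Theta -> 0 < eta ->
  exists2 C : R, 0 <= C &
  forall (delta : R) (K : hilbertType R) (A B : 'I_d -> op K K) (u0 u1 : op K K),
    0 <= delta -> (forall k, uni (A k)) -> almost_op Theta delta A ->
    (forall k, uni (B k)) -> almost_op Theta 0 B ->
    splits u0 u1 -> (forall k x, u0 (A k x) = A k (u0 x)) ->
    (forall k x, u1 (A k x) = A k (u1 x)) ->
  exists2 J : op K K, iso J & intertw
    (#|{: box d n}|%:R * (#|{: box d n}|%:R * (C * delta + eta)) +
       2 / Num.sqrt n.+1%:R) J B A.
Proof.
move=> erg eta0.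
have [p [E [E0 hE]]] := word_shift Theta n.
have [zeta hz] := @complex_prim_root R n.+1 isT.
have z1 := norm_prim_root hz.
have /choice [C hC] (a : box d n) : exists C : R, 0 <= C /\
  forall (delta : R) (K : hilbertType R) (A : 'I_d -> op K K),
    0 <= delta -> (forall k, uni (A k)) -> almost_op Theta delta A ->
    exists2 W : op K K, uni W & forall k x,
      rnorm (A k (W x) - zeta ^+ a k *: W (A k x)) <= (C * delta + eta) * rnorm x.
  (* The conjugate appears because [W] is to be moved to the left of [A k], the opposite of the
     direction in [ergodic_implement]. *)
  have tz : torus (\col_k conjc (zeta ^+ a k)).
    by move=> k; rewrite mxE norm_conjc normrX z1 expr1n.
  have [C C0 hC] := ergodic_implement erg tz eta0.
  exists C; split=> // delta K A delta0 uA hA.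
  have [W uW hW] := hC _ _ _ delta0 uA hA; exists W => // k x.
  have zk : `|zeta ^+ a k| = 1 by rewrite normrX z1 expr1n.
  rewrite -rnormN opprB; have := hW k x.
  rewrite mxE -(rnorm_unit _ zk) scalerBr scalerA conjcMr // scale1r.
  by [].
pose N : R := #|{: box d n}|%:R; pose c : R := (Num.sqrt N)^-1.
have N1 : 1 <= N by exact: card_box_ge1.
have N0 : 0 < N by apply: lt_le_trans N1.
have [c0 c1 c2] := inv_sqrt_bounds N1.
have D0 : 0 <= \sum_a C a by apply: sumr_ge0 => a _; have [] := hC a.
(* There are finitely many characters, and the sum dominates each constant [C a]. *)
exists (\sum_a C a + E); first exact: addr_ge0.
move=> delta K A B u0 u1 delta0 uA hA uB hB hu u0A u1A.
have [W hW] := choice (fun a => let: conj _ h := hC a in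
  let: ex_intro2 W u h' := h delta K A delta0 uA hA in ex_intro _ W (conj u h')).
pose S (a : box d n) := cuntz u0 u1 (enum_rank a).
pose Y (r : box d n) : op K K := oscale c%:C
  (osum (fun a => oscale (box_char zeta a r) (ocomp (S a) (W a)))).
have YE r y : Y r y = c%:C *: \sum_a box_char zeta a r *: S a (W a y) by [].
have dYE r y : dag (Y r) y = c%:C *:
    \sum_a conjc (box_char zeta a r) *: dag (W a) (dag (S a) y).
  by rewrite dag_oscale conjc_real.
clearbody Y.
(* [dag (S a)] isolates the term of index [a] and [dag (W a)] cancels [W a], so only a sum of
   products of characters is left. *)
have YY r r' y : dag (Y r) (Y r' y) = (r == r')%:R *: y.
  have inv a : dag (W a) (dag (S a) (Y r' y)) =
      (c%:C * box_char zeta a r') *: y.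
    have iS : iso (S a) by exact: iso_cuntz.
    have [[iW _] _] := hW a.
    have SY : dag (S a) (\sum_b box_char zeta b r' *: S b (W b y)) =
        box_char zeta a r' *: W a y.
      rewrite op_sum (bigD1 a) // opZ iS big1 => [|b ba]; first by rewrite /= addr0.
      rewrite opZ cuntz_orth ?scaler0 // eq_sym.
      by apply: contra ba => /eqP/val_inj/enum_rank_inj ->.
    by rewrite YE !opZ SY opZ iW scalerA.
  rewrite dYE; under eq_bigr => a _ do rewrite inv scalerA mulrCA.
  rewrite -scaler_suml scalerA -mulr_sumr mulrA box_char_orth //.
  rewrite mulrCA -[#|_|%:R](rmorph_nat (real_complex R)) -!rmorphM /= -expr2.
  by rewrite c2 mulr1.
have NC : 0 <= N * ((\sum_a C a + E) * delta + eta).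
  by rewrite mulr_ge0 ?addr_ge0 ?mulr_ge0 ?addr_ge0 // ltW.
have [||||||||| J iJ hJ] := @spread _ _ n _ _ B A
  (fun r => ocomp (Y r) (word A (box_word r))) (fun r => word B (box_word r)) p
  (N * ((\sum_a C a + E) * delta + eta)) 0.
- exact: NC.
- by [].
- exact: uB.
- exact: uA.
- move=> r; apply: iso_comp; last by have [] := uni_word (box_word r) uA.
  by move=> y; rewrite YY eqxx scale1r.
- move=> r r' x rr'; rewrite -[LHS]/(dag (word A _) (dag (Y r) (Y r' _))).
  by rewrite YY (negbTE rr') scale0r op0.
- by move=> r; exact: uni_word.
- move=> k r x rk; pose r' := box_shift k r.
  pose y := word A (box_word r) x; pose y' := word A (box_word r') x.
  rewrite -[X in rnorm X]/(A k (Y r y) - p k r *: Y r' y').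
  rewrite (_ : _ - _ = c%:C *: \sum_a box_char zeta a r *:
      S a (A k (W a y) - (zeta ^+ a k * p k r) *: W a y')); last first.
    rewrite !YE opZ scalerA mulrC -scalerA -scalerBr; congr (_ *: _).
    rewrite op_sum scaler_sumr -sumrB; apply: eq_bigr => a _.
    rewrite opZ opB opZ scalerBr !scalerA box_char_shift //.
    rewrite [S a (A k _)]cuntz_comm //; congr (_ - _ *: _).
    by rewrite mulrC -!mulrA mulrCA; congr (_ * _); rewrite mulrC.
  rewrite rnorm_scaleR //.
  have term a : rnorm (box_char zeta a r *:
      S a (A k (W a y) - (zeta ^+ a k * p k r) *: W a y')) <=
      ((\sum_a C a + E) * delta + eta) * rnorm x.
    have [[iW _] hWa] := hW a; have iS : iso (S a) by exact: iso_cuntz.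
    have zk : `|zeta ^+ a k| = 1 by rewrite normrX z1 expr1n.
    rewrite rnorm_unit ?norm_box_char // (iso_rnorm _ iS).
    rewrite -[X in rnorm X](subrKA (zeta ^+ a k *: W a (A k y))).
    apply: le_trans (rnormD _ _) _.
    rewrite [X in _ + rnorm X](_ : _ = zeta ^+ a k *: W a (A k y - p k r *: y'));
      last by rewrite opB opZ scalerBr scalerA.
    rewrite rnorm_unit // (iso_rnorm _ iW).
    have yx : rnorm y = rnorm x.
      by rewrite iso_rnorm //; have [] := uni_word (box_word r) uA.
    have h1 := hWa k y; have h2 := hE delta K A delta0 uA hA k r x rk.
    have Ca : C a <= \sum_a C a.
      by rewrite (bigD1 a) //= lerDl sumr_ge0 // => b _; have [] := hC b.
    rewrite yx in h1; apply: le_trans (lerD h1 h2) _; rewrite -mulrDl.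
    rewrite ler_wpM2r ?rnorm_ge0 // addrAC mulrDl lerD2r lerD2r.
    by rewrite ler_wpM2r.
  apply: (@le_trans _ _ (c * (N * (((\sum_a C a + E) * delta + eta) * rnorm x)))).
    rewrite ler_wpM2l //; apply: le_trans (rnorm_sum _ _ _) _.
    apply: le_trans (ler_sum _ (fun a _ => term a)) _.
    by rewrite sumr_const mulr_natl.
  by rewrite -[leRHS]mulrA ler_piMl // mulrA mulr_ge0 ?rnorm_ge0.
- move=> k r x rk; have := hE 0 K B (lexx _) uB hB k r x rk.
  by rewrite mulr0.
by exists J => //; move: hJ; rewrite addr0.
Qed.

End embeddings.

(** * Back to bounded operators, and the choice of constants *)

Lemma opnorm_le (R : realType) (H : hilbertType R) (f : H -> H) (e : R) :
  0 <= e -> (forall x, rnorm (f x) <= e * rnorm x) -> (opnorm f <= e%:E)%E.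
Proof.
move=> e0 fe; apply: ge_ereal_sup => _ [x /= x1 <-]; rewrite lee_fin.
apply: le_trans (fe x) _; rewrite ler_piMr // -lecR -rnormE.
exact: x1.
Qed.

Lemma bounded_of_op (R : realType) (H : hilbertType R) (T : op H H) :
  iso T -> exists B : bounded_op H, forall x, B x = T x.
Proof.
move=> iT; pose f : {linear H -> H} := T.
have cf : continuous f.
  apply: bounded_linear_continuous; apply/bounded_funP => r.
  by exists r => x xr; rewrite rnormE iso_rnorm // -rnormE.
by exists (BoundedOp cf).
Qed.

Theorem theorem4p9 (R : realType) (d : nat) (Theta : 'M[R]_d) :
  antisymmetric_mx Theta -> ergodic Theta ->
  forall eps : R, 0 < eps ->
  exists2 delta : R, 0 < delta &
    forall H : hilbertType R, separable_space H ->
    forall U : 'I_d -> bounded_op H,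
      unitary_tuple U -> almost_theta_commuting delta Theta U ->
    exists V : 'I_d -> bounded_op (ell2 H),
      [/\ unitary_tuple V, theta_commuting Theta V &
          (tuple_dist (fun k => ampl (U k)) V < eps%:E)%E].
Proof.
(* [uni_of_embeddings] returns [10 * e], that is half of [eps], which leaves the strict
   inequality. *)
move=> aT erg eps eps0; pose e := eps / 20.
have e0 : 0 < e by rewrite divr_gt0.
have [n hn] : exists n : nat, 2 / Num.sqrt n.+1%:R <= e / 2.
  exists (Num.truncn ((4 / e) ^+ 2)).
  have e4 : 0 < 4 / e by rewrite divr_gt0.
  have : 4 / e <= Num.sqrt (Num.truncn ((4 / e) ^+ 2)).+1%:R.
    rewrite -[leLHS]ger0_norm ?(ltW e4) // -sqrtr_sqr ler_wsqrtr // ltW //.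
    exact: truncnS_gt.
  move: (Num.sqrt _) => s hs; have s0 : 0 < s by apply: lt_le_trans hs.
  rewrite ler_pdivrMr // mulrAC ler_pdivlMr //.
  by move: hs; rewrite ler_pdivrMr // mulrC; lra.
pose N : R := #|{: box d n}|%:R.
have N0 : 0 <= N by [].
have N1 : 0 < N + 1 by rewrite ltr_wpDl.
(* The interior error of [embed_almost] is at most [2 * N ^+ 2 * eta], hence at most [e / 2]; the
   boundary term takes the other half. *)
pose eta := e / (4 * (N + 1) ^+ 2).
have eta0 : 0 < eta by rewrite divr_gt0 // mulr_gt0 // exprn_gt0.
have [E E0 hE] := embed_exact Theta n.
have [C C0 hC] := embed_almost n erg eta0.
(* Makes both [C * delta] and [E * delta] at most [eta]; the summand 1 keeps the denominator
   positive. *)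
pose delta := eta / (C + E + 1).
have CE : 0 < C + E + 1 by rewrite ltr_wpDl // addr_ge0.
have delta0 : 0 < delta by rewrite divr_gt0.
have etaE : eta * (N + 1) ^+ 2 = e / 4.
  by rewrite /eta; field; rewrite gt_eqF.
have Neta0 : 0 <= N * eta by rewrite mulr_ge0 // ltW.
have NNeta : N * (N * eta) + N * eta <= e / 4.
  by move: etaE; rewrite sqrrD expr1n; lra.
have CEdelta : (C + E + 1) * delta = eta by rewrite mulrC divfK ?gt_eqF.
have Cdelta : C * delta <= eta.
  rewrite -CEdelta ler_wpM2r ?ltW //; lra.
have Edelta : E * delta <= eta.
  rewrite -CEdelta ler_wpM2r ?ltW //; lra.
exists delta => // H _ U uU hU.
have [A [uA AE hA]] := ampl_ops (ltW delta0) uU hU.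
have [u0 [u1 [hu u0A u1A]]] := ampl_splits H.
have {}u0A k x : u0 (A k x) = A k (u0 x) by rewrite !AE u0A.
have {}u1A k x : u1 (A k x) = A k (u1 x) by rewrite !AE u1A.
have [B [t0 [t1 [tau [uB hB [ht t0B t1B] itau otau]]]]] := twisted_shift H aT.
have weaken T A' B' (f : R) : f <= e -> intertw f T A' B' ->
    intertw (H := ell2 H) (K := ell2 H) (d := d) e T A' B'.
  move=> fe hT k x; apply: le_trans (hT k x) _.
  by rewrite ler_wpM2r ?rnorm_ge0.
have [J iJ hJ] := hC _ _ _ _ _ _ (ltW delta0) uA hA uB hB hu u0A u1A.
have [J' iJ' hJ'] := hE _ _ _ _ _ (ltW delta0) uA hA uB hB itau otau.
have {}hJ : intertw e J B A.
  apply: weaken hJ; rewrite -/N.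
  have : N * (N * (C * delta + eta)) <= N * (N * (eta + eta)).
    by rewrite !ler_wpM2l // lerD2r.
  lra.
have {}hJ' : intertw e J' A B.
  apply: weaken hJ'; rewrite -/N.
  have := ler_wpM2l N0 Edelta; have := mulr_ge0 N0 Neta0; lra.
have [Phi [iPhi iPhi'] hPhi] := uni_of_embeddings (ltW e0) uA uB iJ hJ iJ' hJ'
  ht t0B t1B hu u0A u1A.
have uV k : uni (ocomp (dag Phi) (ocomp (B k) Phi)).
  (* The tuple sought is the exact model [B] transported by [Phi]: the relations survive conjugation
     by a unitary, and the distance to [A] is the intertwining defect of [Phi]. *)
  by apply: uni_comp; [split|apply: uni_comp => //; split].
have [V hV] := choice (fun k => bounded_of_op (uV k).1).
have [V' hV'] := choice (fun k => bounded_of_op (uV k).2).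
have VE k x : V k x = dag Phi (B k (Phi x)) by rewrite hV.
exists V; split.
- move=> k; exists (V' k); split.
  + by move=> x y; rewrite hV hV' dagP.
  + by move=> x; rewrite hV hV' (uV k).1.
  + by move=> x; rewrite hV' hV; have := (uV k).2 x; rewrite dagK.
- move=> k l x; rewrite !VE -opZ; congr (dag Phi _).
  rewrite !(iPhi' _ : Phi (dag Phi _) = _); apply/eqP.
  rewrite -subr_eq0; apply/eqP/rnorm_eq0/eqP.
  by rewrite eq_le rnorm_ge0 andbT; have := hB k l (Phi x); rewrite mul0r.
- apply: (@le_lt_trans _ _ (10 * e)%:E); last by rewrite lte_fin /e; lra.
  rewrite /tuple_dist; elim/big_ind: _.
  + by rewrite lee_fin mulr_ge0 // ltW.
  + by move=> a b; rewrite ge_max => -> ->.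
  + move=> k _; apply: opnorm_le; first by rewrite mulr_ge0 // ltW.
    move=> x; rewrite VE -AE -(iso_rnorm _ iPhi) opB.
    by rewrite [Phi (dag Phi _)]iPhi' hPhi.
Qed.
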